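(* Let $G$ be a finite simple graph with edge ideal $I(G)$, and let $p$ be an integer with $2\le p\le \nu(G)$. Then $I(G)^{[p]}$ is linearly related if and only if there does not exist an induced subgraph $H$ of $G$ on $2p+2$ vertices such that $H$ is disconnected and $\nu(H)=p+1$.
   Context: Let $G$ be a finite simple graph on the vertex set $[n]=\{1,\dots,n\}$ and let $S=K[x_1,\dots,x_n]$ be the standard graded polynomial ring over an arbitrary field $K$. The edge ideal is $I(G)=(x_ix_j : \{i,j\}\in E(G))\subset S$. A $p$-matching of $G$ is a set of $p$ pairwise disjoint edges; the matching number $\nu(G)$ is the largest size of a matching of $G$. The $p$-th squarefree power $I(G)^{[p]}$ is the ideal generated by the squarefree monomials among the minimal generators of $I(G)^p$; equivalently, it is generated by the monomials $\prod_{e\in M}\prod_{i\in e}x_i$ with $M$ a $p$-matching of $G$. It is nonzero exactly when $p\le\nu(G)$, and then it is generated in degree $2p$. The graded Betti numbers $\beta_{i,j}(I)$ of a homogeneous ideal $I$ are those of the minimal graded free $S$-resolution of $I$ (so $\beta_{0,j}$ counts minimal generators of degree $j$). A homogeneous ideal $I$ generated in degree $t$ is linearly related if $\beta_{1,j}(I)=0$ for all $j\ne t+1$. *)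

(* Defs.v *)
From mathcomp Require Export all_boot all_order all_algebra.
From mathcomp Require Export mpoly.
Set Implicit Arguments.
Unset Strict Implicit.
Unset Printing Implicit Defensive.
Import GRing.Theory.
Local Open Scope ring_scope.

Record sgraph (T : finType) := SGraph {
  adj :> rel T;
  adj_sym : ssrbool.symmetric adj;
  adj_irr : irreflexive adj
}.

Definition induced (T : finType) (G : sgraph T) (U : {set T}) :
    sgraph {x : T | x \in U} :=
  @SGraph {x : T | x \in U} (relpre val G)
    (fun x y => adj_sym G (val x) (val y)) (fun x => adj_irr G (val x)).

Definition connected (T : finType) (G : sgraph T) : Prop :=
  forall x y : T, connect G x y.

Definition edges (T : finType) (G : sgraph T) : {set {set T}} :=
  [set A | [exists x, exists y, G x y && (A == [set x; y])]].

Definition matching (T : finType) (G : sgraph T) (M : {set {set T}}) : bool :=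
  (M \subset edges G) && trivIset M.

Definition matching_number (T : finType) (G : sgraph T) : nat :=
  \max_(M : {set {set T}} | matching G M) #|M|.

Section Ideals.
Variables (K : fieldType) (n : nat).
Notation S := {mpoly K[n]}.

Definition ideal_gen (A : S -> Prop) (f : S) : Prop :=
  exists (m : nat) (c g : 'I_m -> S),
    (forall k, A (g k)) /\ f = \sum_(k < m) c k * g k.

Definition ideal_pow (I : S -> Prop) (p : nat) : S -> Prop :=
  ideal_gen (fun f => exists g : 'I_p -> S,
    (forall k, I (g k)) /\ f = \prod_(k < p) g k).

(* [(m' <= m)%MM] is divisibility of monomials (componentwise order). *)
Definition min_mon_gen (I : S -> Prop) (m : 'X_{1..n}) : Prop :=
  I 'X_[m] /\ forall m' : 'X_{1..n}, I 'X_[m'] -> (m' <= m)%MM -> m' = m.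

Definition squarefree_mon (m : 'X_{1..n}) : Prop :=
  forall i : 'I_n, (m i <= 1)%N.

Definition squarefree_pow (I : S -> Prop) (p : nat) : S -> Prop :=
  ideal_gen (fun f => exists m : 'X_{1..n},
    [/\ min_mon_gen (ideal_pow I p) m, squarefree_mon m & f = 'X_[m]]).

Definition edge_ideal (G : sgraph 'I_n) : S -> Prop :=
  ideal_gen (fun f => exists i j : 'I_n, G i j /\ f = 'X_i * 'X_j).

(* The free module F_i is 'rV[S]_(rk i), its k-th basis vector sitting in
   degree [shift i k], i.e. F_i is the direct sum of the S(- shift i k).
   Matrices act on row vectors from the right: [diff i] is the map from
   F_(i+1) to F_i, and [aug] the map from F_0 to S, whose image is the resolved
   ideal.  Finite length is not imposed; the ranks may be eventually 0. *)
Record free_seq := FreeSeq {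
  rk : nat -> nat;
  shift : forall i, 'I_(rk i) -> nat;
  diff : forall i, 'M[S]_(rk i.+1, rk i);
  aug : 'cV[S]_(rk 0)
}.

(* The maps preserve degrees. *)
Definition graded (F : free_seq) : Prop :=
  (forall k, aug F k 0 \is (shift k).-homog) /\
  (forall i (k : 'I_(rk F i.+1)) (l : 'I_(rk F i)),
     if (shift l <= shift k)%N
     then diff F i k l \is (shift k - shift l).-homog
     else diff F i k l == 0).

Definition resolves (F : free_seq) (I : S -> Prop) : Prop :=
  [/\ forall f : S, I f <-> exists v : 'rV_(rk F 0), (v *m aug F) 0 0 = f,
      forall v : 'rV_(rk F 0),
        v *m aug F = 0 <-> exists w : 'rV_(rk F 1), w *m diff F 0 = v
    & forall i (v : 'rV_(rk F i.+1)),
        v *m diff F i = 0 <-> exists w : 'rV_(rk F i.+2), w *m diff F i.+1 = v].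

(* diff (F_(i+1)) is contained in (x_1, ..., x_n) F_i. *)
Definition minimal (F : free_seq) : Prop :=
  forall i (k : 'I_(rk F i.+1)) (l : 'I_(rk F i)), (diff F i k l)@_0%MM = 0.

Definition minimal_graded_free_resolution
    (F : free_seq) (I : S -> Prop) : Prop :=
  [/\ graded F, resolves F I & minimal F].

(* [graded_betti I i j b] reads beta_(i,j)(I) = b.  It is a relation so that no
   default value is needed; b is unique because minimal graded free resolutions
   are unique up to isomorphism. *)
Definition graded_betti (I : S -> Prop) (i j b : nat) : Prop :=
  exists F : free_seq,
    minimal_graded_free_resolution F I /\
    #|[set k : 'I_(rk F i) | shift k == j]| = b.

Definition generated_in_degree (I : S -> Prop) (t : nat) : Prop :=
  exists A : S -> Prop,
    (forall f, A f -> f \is t.-homog) /\ (forall f, I f <-> ideal_gen A f).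

Definition linearly_related (I : S -> Prop) : Prop :=
  exists t : nat, generated_in_degree I t /\
    forall j : nat, j <> t.+1 -> graded_betti I 1 j 0.

End Ideals.

Arguments edge_ideal K {n} G.

(* Main.v *)
(** Everything is graded by subsets of the vertex set.  A squarefree monomial
    ideal generated in one degree has a minimal free resolution all of whose
    generators sit in squarefree multidegrees: from one step to the next, add
    for every set [W] of vertices a basis of the kernel in multidegree [W]
    modulo the kernels in smaller multidegrees.  First syzygies of multidegree
    [W] are thus needed only when the generators dividing [W] are not connected
    through pairs whose lcm strictly divides [W].

    For the vertex sets of [p]-matchings this connectedness is combinatorial.
    Let [P] and [Q] be two of them with union [W].  Exchanging the two matchings
    along components of their symmetric difference gives a third vertex set
    strictly between [P] and [Q], unless [#|W| = 2p + 2] and [W] has a perfect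
    matching.  In that case, if [G[W]] is connected, one walks along its edges.

    Conversely, let [W] be perfectly matched, of size [2p + 2], and the disjoint
    union of nonempty [A] and [B] without edges between them.  For [u] in [A]
    and [v] in [B] the relation [x_u (x^W / x_u) = x_v (x^W / x_v)] is a syzygy
    in degree [2p + 2].  The sum of its Koszul components at the variables in
    [A] is [1], while this sum vanishes on every combination of syzygies that
    does not involve a basis syzygy of degree [2p + 2]. *)

Require Import Defs.
From mathcomp Require Import all_boot all_order all_algebra.
From mathcomp Require Import mpoly.
From mathcomp Require Import zify.
Set Implicit Arguments.
Unset Strict Implicit.
Unset Printing Implicit Defensive.
Import GRing.Theory.

(** * Perfectly matched vertex sets *)

Section AlternatingComponents.
Variables (T : finType) (f g : T -> T).
Hypotheses (fK : involutive f) (gK : involutive g).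

Let h x := g (f x).
Let hI : injective h. Proof. exact: inj_comp (inv_inj gK) (inv_inj fK). Qed.

Let iterI k : injective (iter k h).
Proof. by elim: k => [|k IHk] x y //= /hI/IHk. Qed.

(** Conjugation by [g] turns [h = g f] into its inverse [f g]. *)
Let iterN k x : iter k h (g (iter k h x)) = g x.
Proof.
elim: k => [//|k IHk] in x *; rewrite iterSr iterS.
by rewrite /h !gK fK IHk.
Qed.

(** Return times are multiples of the order, and only one of these lies strictly between 0 and twice
    the order. Below, [i] is [2k] or [2k + 1] with [k < order h a]. *)
Let iter_multiple a i :
  (0 < i < 2 * order h a)%N -> iter i h a = a -> i = order h a.
Proof.
move=> lti ia.
have small r : (r < order h a)%N -> iter r h a = a -> r = 0%N.
  by move=> ltr ra; rewrite -[r](findex_iter ltr) ra findex0.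
case: (ltnP i (order h a)) => lei; first by have := small i lei ia; lia.
have ii : iter (i - order h a) h a = a.
  by move: ia; rewrite -{1}(subnK lei) iterD iter_order.
have /small/(_ ii) : (i - order h a < order h a)%N by lia.
lia.
Qed.

(* [f] and [g] act on the orbit of [a] under [g o f] as reflections of a cycle,
   so they have two fixed points there altogether. *)
Lemma alternating_component_fixed a :
  g a = a -> f a != a ->
  exists b (C : {set T}),
    [/\ b != a, forall x, (f x \in C) = (x \in C),
        forall x, (g x \in C) = (x \in C) &
        forall x, (x \in C) && ((f x == x) (+) (g x == x)) = (x == a) || (x ==
          b)].
Proof.
move=> ga fa; set m := order h a.
have m0 : (0 < m)%N by exact: order_gt0.
have ha : h a != a by rewrite /h -{2}ga (inj_eq (inv_inj gK)).
have m1 : (1 < m)%N.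
  by rewrite ltn_neqAle m0 andbT; apply: contra ha => /eqP m1;
     rewrite -{2}(iter_order hI a) -/m -m1.
have gC x : fconnect h a x -> fconnect h a (g x).
  move=> /iter_findex; move: (findex _ _ _) => k <-.
  by rewrite fconnect_sym // -{2}ga -(iterN k a) fconnect_iter.
have fC x : fconnect h a x -> fconnect h a (f x).
  move=> ax; have -> : f x = g (h x) by rewrite /h gK.
  by apply: gC; rewrite -same_fconnect1_r.
have ghf k : f (iter k h a) = g (iter k.+1 h a) by rewrite iterS /h gK.
(* As [g a = a], the point [h^k a] is fixed by [g] when [h^(2k)] fixes [a], and by [f] when
   [h^(2k+1)] does. For [k < m] this means [k = 0], [2k = m] or [2k + 1 = m], so the second fixed
   point sits at [m./2] for either parity of [m]. *)
set b := iter m./2 h a.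
have lt_b : (m./2 < m)%N by lia.
have ba : b != a.
  apply: contraTneq m1 => ba; have := findex_iter lt_b.
  by rewrite -/b ba findex0; lia.
have hb : h b != b.
  apply: contraNneq ha => hb; apply/eqP.
  by apply: (@iterI m./2); rewrite -iterSr iterS.
exists b, [set x | fconnect h a x]; split => //.
- by move=> x; rewrite !inE; apply/idP/idP => [/fC|/fC //]; rewrite fK.
- by move=> x; rewrite !inE; apply/idP/idP => [/gC|/gC //]; rewrite gK.
move=> x; rewrite inE; apply/idP/idP.
  case/andP=> ax; have := findex_max ax; have := iter_findex ax; rewrite -/m.
  move: (findex _ _ _) => k {ax} <- ltk.
  have [/eqP gx _|_] := boolP (g _ == _).
    have := iterN k a; rewrite gx ga -iterD => kk.
    case: (posnP k) => [-> |k0]; first by rewrite eqxx.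
    have km : (k + k)%N = m by apply: iter_multiple kk; rewrite -/m; lia.
    have -> : k = m./2 by lia.
    by rewrite eqxx orbT.
  rewrite addbF => /eqP; rewrite ghf => fx.
  have := iterN k.+1 a; rewrite fx ga -iterD => kk.
  have km : (k.+1 + k)%N = m by apply: iter_multiple kk; rewrite -/m; lia.
  have -> : k = m./2 by lia.
  by rewrite eqxx orbT.
case/orP => /eqP-> {x}; first by rewrite connect0 ga eqxx (negPf fa).
rewrite fconnect_iter /=.
(* Exactly one involution must fix [b], as the exclusive or demands; [h b != b] excludes both. *)
have hgf : (f b == b) && (g b == b) -> h b == b.
  by case/andP => /eqP fb; rewrite /h fb.
have : (f b == b) || (g b == b).
  have hm : iter m h a = a by rewrite iter_order.
  have := odd_double_half m; case: (odd m) => /= hmm.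
    apply/orP; left; rewrite ghf; apply/eqP/(@iterI m./2.+1).
    by rewrite iterN ga -iterD -{1}hm; congr (iter _ h a); lia.
  apply/orP; right; apply/eqP/(@iterI m./2).
  by rewrite iterN ga -iterD -{1}hm; congr (iter _ h a); lia.
by move: hgf (hb); case: (f b == b); case: (g b == b) => //= ->.
Qed.
End AlternatingComponents.

Lemma alternating_component (T : finType) (f g : T -> T) a :
  involutive f -> involutive g -> (f a == a) (+) (g a == a) ->
  exists b (C : {set T}),
    [/\ b != a, forall x, (f x \in C) = (x \in C),
        forall x, (g x \in C) = (x \in C) &
        forall x, (x \in C) && ((f x == x) (+) (g x == x)) = (x == a) || (x ==
          b)].
Proof.
move=> fK gK; have [/eqP fa ga|fa /eqP ga] := boolP (f a == a).
  have [b [C [ba Cg Cf Cx]]] := alternating_component_fixed gK fK fa ga.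
  by exists b, C; split => // x; rewrite -Cx addbC.
exact: alternating_component_fixed.
Qed.

(** * Perfect matchings as involutions, and their exchange *)

Section PerfectlyMatched.
Variables (T : finType) (G : sgraph T).
Implicit Types (U P Q W D : {set T}) (f g : T -> T).

(* A perfect matching of [U], encoded as the involution of the whole vertex set
   swapping the ends of its edges. *)
Definition matches f U : bool :=
  [forall x, (f (f x) == x) && (if x \in U then G x (f x) else f x == x)].

Lemma matchesP f U :
  reflect [/\ involutive f, {in U, forall x, G x (f x)} &
              forall x, (f x == x) = (x \notin U)]
          (matches f U).
Proof.
apply: (iffP forallP) => [Hf|[fK fU fN] x]; last first.
  rewrite fK eqxx; case: (boolP (x \in U)) => [/fU //|xU].
  by rewrite fN.
split=> x; first by have /andP[/eqP] := Hf x.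
  by move=> xU; have /andP[_] := Hf x; rewrite xU.
have /andP[_] := Hf x; case: (x \in U) => // Gx.
by apply: contraTF Gx => /eqP->; rewrite adj_irr.
Qed.

(** Finite functions make the existence boolean; [perfectly_matchedP] returns to plain functions. *)
Definition perfectly_matched U : bool := [exists f : {ffun T ->
  T}, matches f U].

Lemma perfectly_matchedP U :
  reflect (exists f, matches f U) (perfectly_matched U).
Proof.
apply: (iffP existsP) => [[f Hf]|[f Hf]]; first by exists f.
by exists (finfun f); apply/forallP => x; have := forallP Hf x; rewrite !ffunE.
Qed.

Lemma matches_mem f U x : matches f U -> (f x \in U) = (x \in U).
Proof.
case/matchesP => fK _ fN; apply: negb_inj.
by rewrite -!fN fK eq_sym.
Qed.

Lemma perfectly_matched0 : perfectly_matched set0.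
Proof.
by apply/perfectly_matchedP; exists id; apply/forallP => x; rewrite inE !eqxx.
Qed.

Lemma perfectly_matchedU2 U x y :
  G x y -> x \notin U -> y \notin U -> perfectly_matched U ->
  perfectly_matched ([set x; y] :|: U).
Proof.
move=> Gxy xU yU /perfectly_matchedP[f Mf].
have /matchesP[fK fU fN] := Mf.
have xy : x != y by apply: contraTneq Gxy => ->; rewrite adj_irr.
apply/perfectly_matchedP;
  exists (fun z => if z == x then y else if z == y then x else f z).
apply/forallP => z; rewrite !inE /=.
case: (eqVneq z x) => [->|zx] /=.
  by rewrite [y == x]eq_sym (negPf xy) !eqxx Gxy.
case: (eqVneq z y) => [->|zy] /=; first by rewrite !eqxx adj_sym.
have fz w : w \notin U -> z != w -> (f z == w) = false.
  rewrite -fN => /eqP fw; apply: contraNF => /eqP fz.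
  by rewrite -(fK z) fz fw.
rewrite (fz x) // (fz y) // fK eqxx; case: (boolP (z \in U)) => [/fU //|].
by rewrite -fN.
Qed.

Lemma matches_removeD f U D :
  matches f U -> (forall z, (f z \in D) = (z \in D)) ->
  perfectly_matched (U :\: D).
Proof.
case/matchesP => fK fU fN fD; apply/perfectly_matchedP.
exists (fun z => if z \in D then z else f z).
apply/forallP => z; rewrite inE.
case: (boolP (z \in D)) => zD /=; first by rewrite zD eqxx.
rewrite fD (negPf zD) fK eqxx.
by case: (boolP (z \in U)) => [/fU //|]; rewrite -fN.
Qed.

Lemma matches_remove f U x :
  matches f U -> perfectly_matched (U :\: [set x; f x]).
Proof.
move=> Mf; apply: (matches_removeD Mf) => z; have /matchesP[fK _ _] := Mf.
by rewrite !inE !(can2_eq fK fK) fK orbC.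
Qed.

Lemma matches_neq f U x : matches f U -> x \in U -> f x != x.
Proof. by case/matchesP => _ _ -> ->. Qed.

Lemma card_matches_remove f U x :
  matches f U -> x \in U -> #|U| = #|U :\: [set x; f x]|.+2.
Proof.
move=> Mf xU; rewrite -(cardsID [set x; f x] U).
have /setIidPr-> : [set x; f x] \subset U.
  by rewrite subUset !sub1set (matches_mem _ Mf) xU.
by rewrite cards2 eq_sym (matches_neq Mf).
Qed.

(* Exchanging the two matchings on a union of components. *)
Lemma matches_swap f g P Q (C : {set T}) :
  matches f P -> matches g Q ->
  (forall x, (f x \in C) = (x \in C)) -> (forall x, (g x \in C) = (x \in C)) ->
  perfectly_matched
    [set x | (x \in P) (+) ((x \in C) && ((x \in P) (+) (x \in Q)))].
Proof.
move=> /matchesP[fK fP fN] /matchesP[gK gQ gN] Cf Cg.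
apply/perfectly_matchedP; exists (fun x => if x \in C then g x else f x).
apply/forallP => x; rewrite inE.
case: (boolP (x \in C)) => xC /=.
  rewrite Cg xC gK eqxx addKb.
  by case: (boolP (x \in Q)) => [/gQ //|]; rewrite -gN.
rewrite Cf (negPf xC) fK eqxx addbF.
by case: (boolP (x \in P)) => [/fP //|]; rewrite -fN.
Qed.

(** [R] trades [D :&: P] for [D :&: Q]. By the strict inequality some point of [Q :\: P] lies
    outside [D], and [P :|: R] misses it; [R :|: Q] misses every point of [D :&: P]. *)
Lemma exchange_proper P Q D (R := [set x | (x \in P) (+) (x \in D)]) :
  D \subset (P :\: Q) :|: (Q :\: P) -> #|D :&: P| = #|D :&: Q| ->
  D :&: P != set0 -> #|D :&: Q| < #|Q :\: P| ->
  [/\ #|R| = #|P|, P :|: R \proper P :|: Q & R :|: Q \proper P :|: Q].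
Proof.
move=> /subsetP sD cD /set0Pn[a /setIP[aD aP]] ltD.
have DE x : x \in D -> (x \in Q) = (x \notin P).
  by move/sD; rewrite !inE; case: (x \in P); case: (x \in Q).
split.
- rewrite -(cardsID P R) -(cardsID D P).
  have -> : R :&: P = P :\: D.
    by apply/setP=> x; rewrite !inE; case: (x \in P); case: (x \in D).
  have -> : R :\: P = D :&: Q.
    apply/setP=> x; rewrite !inE; case: (boolP (x \in D)) => [/DE->|_].
      by case: (x \in P).
    by rewrite addbF andNb.
  by rewrite -cD setIC addnC.
- apply/properP; split.
    apply/subsetP=> x; rewrite !inE.
    case: (boolP (x \in D)) => [/DE->|_]; first by case: (x \in P).
    by rewrite addbF orbb => ->.
  have [q qQ qD] : exists2 q, q \in Q :\: P & q \notin D :&: Q.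
    by apply/subsetPn; apply: contraTN ltD => /subset_leq_card; rewrite -leqNgt.
  exists q; move: qQ qD; rewrite !inE; first by case/andP=> _ ->; rewrite orbT.
  by case/andP=> /negPf-> ->; rewrite andbT => /negPf->.
apply/properP; split.
  apply/subsetP=> x; rewrite !inE.
  case: (boolP (x \in D)) => [/DE->|_]; first by case: (x \in P).
  by rewrite addbF.
by exists a; rewrite !inE ?aP // aD /= (DE a aD) aP.
Qed.

(** Take [a] in [P :\: Q] and [c] in [Q :\: P]; the alternating component of each meets the
    symmetric difference in one further point, [b] and [e]. If one of these pairs has a point on
    each side, exchanging on its component trades one vertex for one. Otherwise [a], [b] lie in
    [P :\: Q] and [c], [e] in [Q :\: P]: exchanging on both components trades two for two, which is
    proper when the difference has more than two points, and for two points the component of [c]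
    alone turns [P] into [P :|: Q]. *)
Lemma intermediate_matched P Q :
  perfectly_matched P -> perfectly_matched Q -> #|P| = #|Q| ->
  2 <= #|P :\: Q| ->
  (exists R, [/\ perfectly_matched R, #|R| = #|P|,
      P :|: R \proper P :|: Q & R :|: Q \proper P :|: Q])
  \/ #|P :\: Q| = 2 /\ perfectly_matched (P :|: Q).
Proof.
move=> /perfectly_matchedP[f Mf] /perfectly_matchedP[g Mg] cPQ d2.
have /matchesP[fK _ fN] := Mf; have /matchesP[gK _ gN] := Mg.
have cQP : #|Q :\: P| = #|P :\: Q|.
  have := cardsID Q P; have := cardsID P Q; rewrite setIC; lia.
have fgE x : (f x == x) (+) (g x == x) = (x \in P) (+) (x \in Q).
  by rewrite fN gN addNb addbN negbK.
have comp a : (a \in P) (+) (a \in Q) -> exists b (C : {set T}),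
    [/\ b != a, forall x, (f x \in C) = (x \in C),
      forall x, (g x \in C) = (x \in C) &
      forall x, (x \in C) && ((x \in P) (+) (x \in Q)) = (x \in [set a; b])].
  rewrite -fgE => /(alternating_component fK gK)[b [C [ba Cf Cg CE]]].
  by exists b, C; split=> // x; rewrite -fgE CE !inE.
have [a] : exists a, a \in P :\: Q by apply/set0Pn; rewrite -card_gt0 ltnW.
rewrite inE => /andP[aQ aP].
have [c] : exists c, c \in Q :\: P by apply/set0Pn; rewrite -card_gt0 cQP ltnW.
rewrite inE => /andP[cP cQ].
have [|b [C [ba Cf Cg CE]]] := comp a; first by rewrite aP (negPf aQ).
have [|e [C' [ec C'f C'g C'E]]] := comp c; first by rewrite cQ (negPf cP).
have swap (B : {set T}) D : (forall x, (f x \in B) = (x \in B)) ->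
   (forall x, (g x \in B) = (x \in B)) ->
   (forall x, (x \in B) && ((x \in P) (+) (x \in Q)) = (x \in D)) ->
   perfectly_matched [set x | (x \in P) (+) (x \in D)].
  move=> Bf Bg BE; have := matches_swap Mf Mg Bf Bg.
  by congr perfectly_matched; apply/setP=> x; rewrite !inE BE.
have Cab := swap _ _ Cf Cg CE; have Cce := swap _ _ C'f C'g C'E.
have bPQ : (b \in P) (+) (b \in Q).
  by have := CE b; rewrite !inE eqxx orbT => /andP[].
have ePQ : (e \in P) (+) (e \in Q).
  by have := C'E e; rewrite !inE eqxx orbT => /andP[].
have single x y : x \in P -> x \notin Q -> y \in Q -> y \notin P ->
    perfectly_matched [set z | (z \in P) (+) (z \in [set x; y])] ->
    exists R, [/\ perfectly_matched R, #|R| = #|P|,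
      P :|: R \proper P :|: Q & R :|: Q \proper P :|: Q].
  move=> xP xQ yQ yP Rxy.
  have DP : [set x; y] :&: P = [set x].
    apply/setP=> z; rewrite !inE; case: (eqVneq z x) => [->|_] //=.
    by case: (eqVneq z y) => [->|_] //=; apply: negPf.
  have DQ : [set x; y] :&: Q = [set y].
    apply/setP=> z; rewrite !inE orbC; case: (eqVneq z y) => [->|_] //=.
    by case: (eqVneq z x) => [->|_] //=; apply: negPf.
  have [] := @exchange_proper P Q [set x; y].
  - by rewrite subUset !sub1set !inE xP xQ yP yQ.
  - by rewrite DP DQ !cards1.
  - by rewrite DP; apply/set0Pn; exists x; rewrite inE.
  - by rewrite DQ cards1 cQP.
  by move=> ? ? ?; exists [set z | (z \in P) (+) (z \in [set x; y])].
case: (boolP (e \in P)) ePQ => eP /= eQ.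
  by left; apply: (single e c) => //; rewrite setUC.
case: (boolP (b \in P)) bPQ => bP /= bQ; last by left; apply: (single a b).
have ce : [set c; e] \subset Q :\: P.
  by rewrite subUset !sub1set !inE cP cQ eP eQ.
have card_ce : #|[set c; e]| = 2 by rewrite cards2 eq_sym ec.
case: (ltngtP #|P :\: Q| 2) d2 => // d _; last first.
  right; split=> //; move: Cce.
  have -> : [set c; e] = Q :\: P.
    by apply/eqP; rewrite eqEcard ce card_ce cQP d.
  have -> // : [set x | (x \in P) (+) (x \in Q :\: P)] = P :|: Q.
  by apply/setP=> x; rewrite !inE; case: (x \in P).
left.
have Rabce : perfectly_matched
    [set x | (x \in P) (+) (x \in [set a; b] :|: [set c; e])].
  apply: (swap (C :|: C')) => x; first by rewrite !in_setU Cf C'f.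
    by rewrite !in_setU Cg C'g.
  by rewrite in_setU andb_orl CE C'E -in_setU.
have ab : [set a; b] \subset P :\: Q.
  by rewrite subUset !sub1set !inE aP aQ bP bQ.
have DP : ([set a; b] :|: [set c; e]) :&: P = [set a; b].
  move: ab ce; rewrite !subsetD => /andP[ab _] /andP[_ ce].
  by rewrite setIUl (setIidPl ab) (disjoint_setI0 ce) setU0.
have DQ : ([set a; b] :|: [set c; e]) :&: Q = [set c; e].
  move: ab ce; rewrite !subsetD => /andP[_ ab] /andP[ce _].
  by rewrite setIUl (setIidPl ce) (disjoint_setI0 ab) set0U.
have [] := @exchange_proper P Q ([set a; b] :|: [set c; e]).
- exact: setUSS.
- by rewrite DP DQ card_ce cards2 eq_sym ba.
- by rewrite DP; apply/set0Pn; exists a; rewrite !inE eqxx.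
- by rewrite DQ card_ce cQP.
by move=> ? ? ?; eexists; split; first exact: Rabce.
Qed.

(** The exchanged set [R] links [P] to [Q] except when [W] is perfectly matched of size [q + 2].
    Then the walk goes from [P] to the complement of a matching edge, along edges of [G] through
    such complements, and on to [Q]. *)
Lemma perfectly_matched_linked W q
    (E : {set T} -> {set T} -> Prop) :
  (forall P Q R, E P Q -> E Q R -> E P R) ->
  (forall P Q, perfectly_matched P -> perfectly_matched Q ->
     #|P| = q -> #|Q| = q -> P :|: Q \proper W -> E P Q) ->
  (#|W| = q.+2 -> perfectly_matched W -> connected (induced G W)) ->
  q.+2 <= #|W| ->
  forall P Q, perfectly_matched P -> perfectly_matched Q ->
    #|P| = q -> #|Q| = q -> P \subset W -> Q \subset W -> E P Q.
Proof.
move=> Etrans E1 conn ltqW P Q mP mQ cP cQ PW QW.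
have PQW : P :|: Q \subset W by rewrite subUset PW.
have [/E1|] := boolP (P :|: Q \proper W); first exact.
rewrite properE PQW /= negbK => WPQ.
have {PQW WPQ} PQW : P :|: Q = W by apply/eqP; rewrite eqEsubset PQW.
have cW : #|W| = #|P :\: Q| + q.
  by rewrite -PQW -(cardsID Q) setIC setKU setDUl setDv setU0 cQ addnC.
have [] := intermediate_matched mP mQ; [by rewrite cP|lia| |].
  case=> R [mR cR]; rewrite PQW => PRW RQW; rewrite cP in cR.
  by apply: (Etrans _ R); apply: E1.
case=> d2; rewrite PQW => mW; have {}cW : #|W| = q.+2 by rewrite cW d2.
have {}conn := conn cW mW; have /perfectly_matchedP[f Mf] := mW.
have /matchesP[fK fW _] := Mf.
(* Any matched [q]-subset of [W] missing [x] is directly related to [M x], since their union also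
   misses [x]. *)
pose M x := W :\: [set x; f x].
have mM x : perfectly_matched (M x) by exact: matches_remove.
have cM x : x \in W -> #|M x| = q.
  by move=> xW; have := card_matches_remove Mf xW; rewrite cW => -[].
have missed (A B : {set T}) x : A \subset W -> B \subset W -> x \in W ->
  x \notin A ->
    x \notin B -> A :|: B \proper W.
  move=> AW BW xW xA xB; apply/properP; rewrite subUset AW; split=> //.
  by exists x; rewrite // inE negb_or xA.
have MW x : M x \subset W by exact: subsetDl.
have Mx x : x \notin M x by rewrite !inE eqxx.
have Mfx x : f x \notin M x by rewrite !inE eqxx orbT.
have EM x y : x \in W -> y \in W -> G x y -> E (M x) (M y).
  move=> xW yW Gxy; have [yfx|yfx] := eqVneq y (f x).
    apply: E1; rewrite ?mM ?cM //; apply: (@missed _ _ x) => //.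
    by rewrite yfx -{1}[x]fK.
  have fxW : f x \in W by rewrite (matches_mem _ Mf).
  have fyW : f y \in W by rewrite (matches_mem _ Mf).
  (* The edge [xy] is not in the matching [f]; [R] is matched by [xy] together with the rest of [f].
     Both [M x] and [R] miss [f x], and both [R] and [M y] miss [f y]. *)
  pose R := W :\: [set f x; f y].
  have fxx : f x != x by exact: (matches_neq Mf).
  have fyy : f y != y by exact: (matches_neq Mf).
  have xy : x != y by apply: contraTneq Gxy => ->; rewrite adj_irr.
  have xfy : x != f y by apply: contraNneq yfx => ->; rewrite fK.
  have mR : perfectly_matched R.
    have -> : R = [set x; y] :|: (W :\: ([set x; f x] :|: [set y; f y])).
      apply/setP=> z; rewrite !inE.
      case: (eqVneq z x) => [->|_];
        first by rewrite [x == f x]eq_sym (negPf fxx) (negPf xfy) xW.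
      case: (eqVneq z y) => [->|_]; last by rewrite /= ?orbF.
      by rewrite (negPf yfx) [y == f y]eq_sym (negPf fyy) yW.
    apply: perfectly_matchedU2; rewrite ?inE ?eqxx ?orbT //.
    apply: (matches_removeD Mf) => z.
    by rewrite !inE !(can2_eq fK fK) !fK [_ || (z == x)]orbC [_ || (z ==
      y)]orbC.
  have cR : #|R| = q.
    have := cardsID [set f x; f y] W; rewrite -/R cW.
    have /setIidPr-> : [set f x; f y] \subset W by rewrite subUset !sub1set fxW.
    by rewrite cards2 (inj_eq (inv_inj fK)) xy => -[].
  apply: (Etrans _ R); apply: E1; rewrite ?mM ?cM //.
    by apply: (@missed _ _ (f x)); rewrite ?subsetDl // !inE eqxx.
  by apply: (@missed _ _ (f y)); rewrite ?subsetDl // !inE eqxx ?orbT.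
have EMW x y : x \in W -> y \in W -> E (M x) (M y).
  move=> xW yW; have /connectP[p] := conn (Sub x xW) (Sub y yW).
  elim: p x xW => [|z p IHp] x xW /=.
    move=> _ /(congr1 val) /= ->; apply: E1; rewrite ?mM ?cM //.
    exact: (@missed _ _ x).
  case/andP=> Gxz pz Ly; apply: (Etrans _ (M (val z))).
    by apply: EM => //; exact: valP.
  apply: (IHp _ (valP z)); last by rewrite Ly; congr last; apply: val_inj.
  by have -> : Sub (val z) (valP z) = z by apply: val_inj.
have unmatched (A : {set T}) : #|A| = q -> exists2 x, x \in W & x \notin A.
  move=> cA; apply/subsetPn; apply/negP => /subset_leq_card.
  by rewrite cW cA; lia.
have [c cW' cP'] := unmatched _ cP; have [e eW eQ] := unmatched _ cQ.
apply: (Etrans _ (M c)).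
  by apply: E1; rewrite ?mM ?cM //; apply: (@missed _ _ c).
apply: (Etrans _ (M e)); first exact: EMW.
by apply: E1; rewrite ?mM ?cM //; apply: (@missed _ _ e).
Qed.
End PerfectlyMatched.

(** * Perfect matchings as edge sets, and the matching number *)

Section MatchingNumber.
Variables (T : finType) (G : sgraph T).

Lemma card_edge (A : {set T}) : A \in edges G -> #|A| = 2.
Proof.
rewrite inE => /existsP[x /existsP[y /andP[Gxy /eqP->]]]; rewrite cards2.
by case: eqVneq Gxy => // ->; rewrite adj_irr.
Qed.

Lemma card_cover_matching M : matching G M -> #|cover M| = #|M| * 2.
Proof.
case/andP=> sM tM; have [_] := leq_card_cover M; rewrite tM => /eqP->.
rewrite -sum_nat_const; apply: eq_bigr => A AM.
by rewrite card_edge // (subsetP sM).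
Qed.

Lemma perfectly_matched_coverP (U : {set T}) :
  reflect (exists2 M, matching G M & cover M = U) (perfectly_matched G U).
Proof.
apply: (iffP (perfectly_matchedP G U)) => [[f Mf]|[M /andP[sM tM] <-]].
  have /matchesP[fK fU fN] := Mf.
  exists [set [set x; f x] | x in U].
    apply/andP; split.
      apply/subsetP=> _ /imsetP[x xU ->]; rewrite inE.
      by apply/existsP; exists x; apply/existsP; exists (f x); rewrite fU /=.
    apply/trivIsetP=> _ _ /imsetP[x xU ->] /imsetP[y yU ->].
    apply: contraR => /pred0Pn[z] /=; rewrite !inE.
    have yfx : y = f x -> [set x; f x] = [set y; f y].
      by move->; rewrite fK setUC.
    case/andP=> /orP[]/eqP-> /orP[]/eqP; first by move->.
    - by move=> xfy; rewrite yfx // xfy fK.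
    - by move=> fxy; rewrite yfx.
    - by move/(inv_inj fK) ->.
  apply/setP=> z; apply/bigcupP/idP => [[_ /imsetP[x xU ->]]|zU].
    by rewrite !inE => /orP[]/eqP-> //; rewrite (matches_mem _ Mf).
  by exists [set z; f z]; [apply: imset_f | apply: set21].
(* The default [x] makes [f] fix the vertices that [M] leaves uncovered. *)
pose f x := odflt x [pick y | G x y && ([set x; y] \in M)].
have unique x y z : [set x; y] \in M -> [set x; z] \in M -> G x y -> y = z.
  move=> xy xz Gxy; have := trivIsetP tM _ _ xy xz.
  case: eqVneq => [e _|_ /(_ isT) /pred0P/(_ x)]; last by rewrite /= !inE eqxx.
  have : y \in [set x; z] by rewrite -e !inE eqxx orbT.
  by rewrite !inE => /orP[]/eqP // yx; rewrite yx adj_irr in Gxy.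
have fE x y : G x y -> [set x; y] \in M -> f x = y.
  move=> Gxy xyM; rewrite /f; case: pickP => [z /andP[Gxz xzM]|/(_ y)] /=.
    exact: unique xzM xyM Gxz.
  by rewrite Gxy xyM.
have fM x : x \in cover M -> G x (f x) /\ [set x; f x] \in M.
  move=> /bigcupP[A AM xA].
  suff [y Gxy AE] : exists2 y, G x y & A = [set x; y].
    by rewrite (fE x y) // -AE.
  have := subsetP sM _ AM.
  rewrite inE => /existsP[u /existsP[v /andP[Guv /eqP AE]]].
  move: xA; rewrite AE !inE => /orP[]/eqP->; first by exists v.
  by exists u; rewrite 1?adj_sym // setUC.
exists f; apply/forallP=> x; case: (boolP (x \in cover M)) => xM.
  have [Gx xfM] := fM x xM; rewrite Gx andbT; apply/eqP.
  by apply: fE; rewrite 1?adj_sym // setUC.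
suff fx : f x = x by rewrite !fx eqxx.
rewrite /f; case: pickP => [z /andP[_ xzM]|//].
by case/negP: xM; apply/bigcupP; exists [set x; z]; rewrite // !inE eqxx.
Qed.

(** A matching of [k] edges covers [2k] vertices, so the upper bound [k] is attained exactly by
    matchings covering everything. *)
Lemma matching_number_perfect k :
  #|T| = k * 2 -> (matching_number G = k <-> perfectly_matched G setT).
Proof.
move=> cT; have le_k M : matching G M -> #|M| <= k.
  by move=> mM; rewrite -(leq_pmul2r (isT : 0 < 2)) -card_cover_matching //
     -cT max_card.
have k_max : k >= matching_number G by apply/bigmax_leqP => M /le_k.
split=> [mk|/perfectly_matched_coverP[M mM cM]].
  have : exists2 M : {set {set T}}, matching G M & #|M| = k.
    rewrite -mk /matching_number.
    have m0 : 0 < #|matching G|.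
      apply/card_gt0P; exists set0; rewrite unfold_in /matching sub0set /=.
      by apply/trivIsetP=> A B; rewrite inE.
    by have [M mM e] := eq_bigmax_cond (fun M : {set {set T}} => #|M|) m0;
      exists M; rewrite ?e.
  case=> M mM cM; apply/perfectly_matched_coverP; exists M => //.
  apply/eqP; rewrite eqEcard subsetT cardsT cT card_cover_matching // cM leqnn.
  by [].
apply/eqP; rewrite eqn_leq k_max /=.
suff <- : #|M| = k by exact: leq_bigmax_cond.
by apply/eqP; rewrite -(eqn_pmul2r (isT : 0 < 2)) -card_cover_matching // cM
   cardsT cT.
Qed.
End MatchingNumber.

Lemma perfectly_matched_induced (T : finType) (G : sgraph T) (U : {set T}) :
  perfectly_matched (induced G U) setT = perfectly_matched G U.
Proof.
apply/perfectly_matchedP/perfectly_matchedP => [[f]|[f Mf]].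
  case/matchesP=> fK fG _.
  exists (fun x => if insub x is Some u then val (f u) else x).
  apply/forallP=> x /=; case: (boolP (x \in U)) => xU; last first.
    by rewrite !insubF ?eqxx //; exact: negPf.
  rewrite (insubT (fun x => x \in U) xU) valK fK eqxx.
  exact: (fG (Sub x xU) (in_setT _)).
have fU (u : {x | x \in U}) : f (val u) \in U.
  by rewrite (matches_mem _ Mf); exact: (valP u).
exists (fun u : {x | x \in U} => Sub (f (val u)) (fU u)).
have /matchesP[fK fG _] := Mf.
apply/forallP=> u; rewrite inE -val_eqE /= fK eqxx /=.
exact: fG (valP u).
Qed.

Lemma matching_number_induced (T : finType) (G : sgraph T) (U : {set T}) k :
  #|U| = k * 2 ->
  (matching_number (induced G U) = k <-> perfectly_matched G U).
Proof.
move=> cU; rewrite -perfectly_matched_induced; apply: matching_number_perfect.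
by rewrite card_sig -cU; apply: eq_card.
Qed.

Lemma connectedP (T : finType) (G : sgraph T) :
  reflect (connected G) [forall x, forall y, connect G x y].
Proof. by apply: (iffP forallP) => GC x; apply/forallP. Qed.

Lemma perfectly_matched_even (T : finType) (G : sgraph T) (U : {set T}) :
  perfectly_matched G U -> ~~ odd #|U|.
Proof.
case/perfectly_matched_coverP=> M mM <-.
by rewrite (card_cover_matching mM) oddM andbF.
Qed.

(** No matching edge leaves [A], so the involution preserves [A] and can be made trivial there. This
    feeds a parity argument. *)
Lemma perfectly_matched_side (T : finType) (G : sgraph T) (U A : {set T}) :
  (forall x y, x \in A -> y \in U :\: A -> ~~ G x y) -> A \subset U ->
  perfectly_matched G U -> perfectly_matched G (U :\: A).
Proof.
move=> sep AU /perfectly_matchedP[f Mf]; apply: (matches_removeD Mf).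
have /matchesP[fK fU fN] := Mf.
have fA z : z \in A -> f z \in A.
  move=> zA; have zU := subsetP AU _ zA; have := fU z zU.
  by apply: contraTT => fzA; rewrite sep // inE fzA (matches_mem _ Mf).
by move=> z; apply/idP/idP => [/fA|/fA //]; rewrite fK.
Qed.

Lemma not_connected_split (T : finType) (G : sgraph T) (U : {set T}) :
  ~ connected (induced G U) ->
  exists A : {set T}, [/\ A \subset U, A != set0, U :\: A != set0 &
    forall x y, x \in A -> y \in U :\: A -> ~~ G x y].
Proof.
move=> /connectedP; rewrite negb_forall => /existsP[x].
rewrite negb_forall => /existsP[y xy].
exists [set val z | z in [set z | connect (induced G U) x z]].
have mem z : (val z \in [set val z | z in [set z | connect (induced G U) x z]])
     = connect (induced G U) x z.
  by rewrite mem_imset ?inE //; apply: val_inj.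
split.
- by apply/subsetP=> _ /imsetP[z _ ->]; apply: valP.
- by apply/set0Pn; exists (val x); rewrite mem connect0.
- by apply/set0Pn; exists (val y); rewrite inE mem xy (valP y).
move=> _ v /imsetP[z + ->]; rewrite !inE => xz /andP[vA vU].
apply: contra vA => zv; rewrite -[v]/(val (exist _ v vU : {x | x \in U})) mem.
by apply: connect_trans xz (connect1 _).
Qed.

(** * Squarefree monomials and the ideal of matchings *)

Section SquarefreeMonomials.
Variable n : nat.
Implicit Types (U V : {set 'I_n}) (m : 'X_{1..n}).

Lemma mdeg_le m m' : (m <= m')%MM -> mdeg m <= mdeg m'.
Proof. by move/submK <-; rewrite mdegD leq_addl. Qed.

Lemma mnm_le_eq m m' : (m <= m')%MM -> mdeg m' <= mdeg m -> m = m'.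
Proof.
move/submK <-; rewrite mdegD -{2}[mdeg m]add0n leq_add2r leqn0 mdeg_eq0.
by move/eqP->; rewrite add0m.
Qed.

Definition mnm_set U : 'X_{1..n} := [multinom (i \in U : nat) | i < n].
Definition mnm_supp m : {set 'I_n} := [set i | m i != 0].

Lemma mnm_setE U i : mnm_set U i = (i \in U). Proof. exact: mnmE. Qed.

Lemma mnm_setK : cancel mnm_set mnm_supp.
Proof. by move=> U; apply/setP=> i; rewrite inE mnm_setE; case: (i \in U). Qed.

Lemma mnm_set_inj : injective mnm_set.
Proof. exact: can_inj mnm_setK. Qed.

Lemma mdeg_mnm_set U : mdeg (mnm_set U) = #|U|.
Proof.
rewrite mdegE -sum1_card [RHS]big_mkcond; apply: eq_bigr => i _.
by rewrite mnm_setE; case: (i \in U).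
Qed.

Lemma mnm_set_le U m : (mnm_set U <= m)%MM = (U \subset mnm_supp m).
Proof.
apply/mnm_lepP/subsetP=> [le_m i iU|sU i].
  by have := le_m i; rewrite inE mnm_setE iU; case: (m i).
rewrite mnm_setE; case: (boolP (i \in U)) => // /sU; rewrite inE; lia.
Qed.

Lemma mnm_set_leq U V : (mnm_set U <= mnm_set V)%MM = (U \subset V).
Proof. by rewrite mnm_set_le mnm_setK. Qed.

Lemma mnm_setB U V : U \subset V -> (mnm_set V - mnm_set U)%MM = mnm_set (V :\:
  U).
Proof.
move/subsetP=> UV; apply/mnmP=> i; rewrite mnmBE !mnm_setE inE.
by case: (boolP (i \in U)) => [/UV->|_] //=; rewrite subn0.
Qed.

Lemma mnm_setU U V : [disjoint U & V] -> mnm_set (U :|: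
  V) = (mnm_set U + mnm_set V)%MM.
Proof.
move/pred0P=> UV; apply/mnmP=> i; rewrite mnmDE !mnm_setE inE.
by have := UV i => /=; case: (i \in U); case: (i \in V).
Qed.

Lemma mnm_set0 : mnm_set set0 = 0%MM.
Proof. by apply/mnmP=> i; rewrite mnm_setE inE mnm0E. Qed.

Lemma mnm_set1 i : mnm_set [set i] = U_(i)%MM.
Proof. by apply/mnmP=> j; rewrite mnm_setE inE mnm1E eq_sym. Qed.

Lemma mnm_set_supp m : squarefree_mon m -> mnm_set (mnm_supp m) = m.
Proof. by move=> sq; apply/mnmP=> i; rewrite mnm_setE inE; have := sq i;
  lia. Qed.

Lemma mnm_set_squarefree U : squarefree_mon (mnm_set U).
Proof. by move=> i; rewrite mnm_setE leq_b1. Qed.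

End SquarefreeMonomials.

(** * Monomials of edge ideals, their powers and squarefree powers *)

Section MonomialIdeals.
Variables (K : fieldType) (n : nat).
Local Open Scope ring_scope.
Notation S := {mpoly K[n]}.
Implicit Types (m : 'X_{1..n}) (A : 'X_{1..n} -> Prop).

Definition divisible_by A m : Prop := exists2 a, A a & (a <= m)%MM.

Lemma divisible_byDl A m m' : divisible_by A m -> divisible_by A (m + m')%MM.
Proof. by case=> a Aa am; exists a => //;
  apply: lepm_trans am (lem_addr _ _). Qed.

Lemma divisible_byDr A m m' : divisible_by A m -> divisible_by A (m' + m)%MM.
Proof. by rewrite addmC; apply: divisible_byDl. Qed.

(** Monomials of a product are products of monomials of the factors. Used both for divisibility by
    generators and for lower bounds on degrees. *)
Lemma msupp_ideal_gen (g : S -> Prop) (P : 'X_{1..n} -> Prop) :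
  (forall m m', P m -> P (m' + m)%MM) ->
  (forall f, g f -> forall m, m \in msupp f -> P m) ->
  forall f, ideal_gen g f -> forall m, m \in msupp f -> P m.
Proof.
move=> PD gP f [k [c [h [gh ->]]]] m /msupp_sum_le /flattenP[_ /mapP[i _ ->]].
move/msuppM_le/allpairsP => -[[m1 m2] /= [_ m2h ->]].
by apply/PD/(gP _ (gh i)).
Qed.

Lemma monomial_idealP A (f : S) :
  ideal_gen (fun f => exists m, A m /\ f = 'X_[m]) f <->
  forall m, m \in msupp f -> divisible_by A m.
Proof.
split.
  apply: msupp_ideal_gen => [m m'|_ [m [Am ->]] m'];
    first exact: divisible_byDr.
  by rewrite msuppX inE => /eqP->; exists m => //; apply: lepm_refl.
move=> fA; pose s := msupp f.
(* One generator is chosen below each monomial of [f]; the choice is finite, so it works for a mere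
   [Prop]. *)
have [a aP] : exists a : 'I_(size s) -> 'X_{1..n}, forall k,
    A (a k) /\ (a k <= nth 0 s k)%MM.
  apply: (@fin_all_exists _ (fun=> 'X_{1..n}) (fun (k :
    'I_(size s)) a => A a /\ (a <= nth 0 s k)%MM)) => k; 
  have [a Aa am] := fA _ (mem_nth 0%MM (ltn_ord k)).
  by exists a.
exists (size s), (fun k : 'I__ => f@_(nth 0%MM s k) *: 'X_[nth 0%MM s k - a k]),
  (fun k => 'X_[a k]); split=> [k|].
  by exists (a k); have [] := aP k.
rewrite {1}[f]mpolyE (big_nth 0%MM) big_mkord; apply: eq_bigr => k _.
by rewrite -scalerAl -mpolyXD submK //; have [] := aP k.
Qed.

Variable G : sgraph 'I_n.

Definition edge_mnm m : Prop := exists i j, G i j /\ m = (U_(i) + U_(j))%MM.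

Lemma edge_idealP (f : S) :
  edge_ideal K G f <-> forall m, m \in msupp f -> divisible_by edge_mnm m.
Proof.
rewrite -monomial_idealP; split=> -[k [c [g [gA ->]]]]; exists k, c, g;
  split=> // l.
  have [i [j [Gij ->]]] := gA l; exists (U_(i) + U_(j))%MM.
  by rewrite mpolyXD; split=> //; exists i, j.
have [_ [[i [j [Gij ->]]] ->]] := gA l.
by exists i, j; rewrite mpolyXD.
Qed.

Fixpoint edge_product p m : Prop :=
  if p is p'.+1
  then exists e m', [/\ edge_mnm e, edge_product p' m' & m = (e + m')%MM]
  else m = 0%MM.

Lemma mdeg_edge_product p m : edge_product p m -> mdeg m = (2 * p)%N.
Proof.
elim: p m => [|p IHp] m /=; first by move->; rewrite mdeg0.
case=> _ [m' [[i [j [_ ->]]] /IHp m'E ->]].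
by rewrite !mdegD !mdeg1 m'E; lia.
Qed.

Lemma edge_ideal_pow_mon p m :
  ideal_pow (edge_ideal K G) p 'X_[m] <-> divisible_by (edge_product p) m.
Proof.
split=> [pm|[a pa am]].
  apply: (@msupp_ideal_gen _ (divisible_by (edge_product p)) _ _ _ pm);
    last by rewrite msuppX inE.
    by move=> m1 m2; apply: divisible_byDr.
  move=> _ [g [gI ->]] {pm}; elim: p g gI => [|p IHp] g gI {}m.
    rewrite big_ord0 msupp1 inE => /eqP->; exists 0%MM => //.
    exact: lepm_refl.
  rewrite big_ord_recl => /msuppM_le/allpairsP[[m1 m2] /= [m1g m2g ->]].
  have [e eE em1] := (edge_idealP _).1 (gI ord0) _ m1g.
  have [m' pm' m'm2] := IHp _ (fun k => gI (lift ord0 k)) _ m2g.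
  exists (e + m')%MM; first by exists e, m'.
  by apply/mnm_lepP=> i; rewrite !mnmDE leq_add //; apply: (mnm_lepP _).
exists 1%N, (fun=> 'X_[m - a]), (fun=> 'X_[a]); split; last first.
  by rewrite big_ord1 -mpolyXD submK.
move=> _; elim: p a pa {am m} => [|p IHp] a /=.
  by move->; exists (fun=> 0); split; [case|rewrite big_ord0 mpolyX0].
case=> e [m' [eE /IHp[g [gI gE]] ->]].
exists (fun k => if unlift ord0 k is Some k' then g k' else 'X_[e]);
  split=> [k|].
  case: unlift => // {k}; apply/edge_idealP => m; rewrite msuppX inE => /eqP->.
  by exists e => //; apply: lepm_refl.
rewrite mpolyXD gE big_ord_recl unlift_none; congr (_ * _).
by apply: eq_bigr => k _; rewrite liftK.
Qed.

(** Squarefreeness forces the [p] edges to be pairwise disjoint. *)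
Lemma edge_product_squarefree p m :
  edge_product p m -> squarefree_mon m -> perfectly_matched G (mnm_supp m).
Proof.
elim: p m => [|p IHp] m /=.
  move=> -> _; suff -> : @mnm_supp n 0%MM = set0 by apply: perfectly_matched0.
  by apply/setP=> i; rewrite !inE mnm0E.
case=> _ [m' [[i [j [Gij ->]]] pm' ->]] sq.
have ij : i != j by apply: contraTneq Gij => ->; rewrite adj_irr.
have sqE k : ((i == k) + (j == k) + m' k <= 1)%N by have := sq k;
  rewrite !mnmDE !mnm1E.
have -> : mnm_supp (U_(i) + U_(j) + m')%MM = [set i; j] :|: mnm_supp m'.
  apply/setP=> k; rewrite !inE !mnmDE !mnm1E !addn_eq0 !negb_and !eqb0 !negbK.
  by rewrite [i == k]eq_sym [j == k]eq_sym.
apply: perfectly_matchedU2 => //; rewrite ?inE.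
- by have := sqE i; rewrite eqxx; lia.
- by have := sqE j; rewrite eqxx; lia.
by apply: (IHp _ pm') => k; have := sqE k; lia.
Qed.

Lemma perfectly_matched_edge_product p (U : {set 'I_n}) :
  perfectly_matched G U -> #|U| = (2 * p)%N -> edge_product p (mnm_set U).
Proof.
elim: p U => [|p IHp] U mU cU.
  by move/eqP: cU; rewrite muln0 cards_eq0 => /eqP->; apply: mnm_set0.
have [x xU] : exists x, x \in U by apply/set0Pn; rewrite -card_gt0 cU; lia.
have /perfectly_matchedP[f Mf] := mU; have /matchesP[fK fG _] := Mf.
exists (U_(x) + U_(f x))%MM, (mnm_set (U :\: [set x; f x])); split.
- by exists x, (f x); rewrite fG.
- apply: IHp; first exact: matches_remove.
  by have := card_matches_remove Mf xU; lia.
have fxU : f x \in U by rewrite (matches_mem _ Mf).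
have fxx := matches_neq Mf xU.
apply/mnmP=> i; rewrite !mnmDE !mnm1E !mnm_setE !inE ![_ == i]eq_sym.
case: (eqVneq i x) => [->|_]; first by rewrite eq_sym (negPf fxx) xU.
by case: (eqVneq i (f x)) => [->|_]; rewrite ?fxU.
Qed.

Definition matched_sets p : {set {set 'I_n}} :=
  [set U | perfectly_matched G U & #|U| == (2 * p)%N].

(** All products of [p] edges have degree [2p], so the squarefree ones are automatically minimal
    generators of the power; their supports are the vertex sets of [p]-matchings. *)
Lemma squarefree_powP p (f : S) :
  squarefree_pow (edge_ideal K G) p f <->
  forall m, m \in msupp f -> exists2 U, U \in matched_sets p &
    (mnm_set U <= m)%MM.
Proof.
pose A m := exists2 U, U \in matched_sets p & m = mnm_set U.
have AE m : A m <-> min_mon_gen (ideal_pow (edge_ideal K G) p) m /\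
  squarefree_mon m.
  split.
    case=> U; rewrite inE => /andP[mU /eqP cU] ->; split;
      last exact: mnm_set_squarefree.
    have pU := perfectly_matched_edge_product mU cU.
    split=> [|m' /edge_ideal_pow_mon[a pa am'] m'U].
      by apply/edge_ideal_pow_mon; exists (mnm_set U) => //; apply: lepm_refl.
    apply: mnm_le_eq => //; apply: leq_trans (mdeg_le am').
    by rewrite mdeg_mnm_set cU (mdeg_edge_product pa).
  case=> -[/edge_ideal_pow_mon[a pa am] mmin] sq.
  have ma : a = m.
    by apply: mmin => //; apply/edge_ideal_pow_mon; exists a => //;
      apply: lepm_refl.
  rewrite ma in pa; exists (mnm_supp m); last by rewrite mnm_set_supp.
  rewrite inE (edge_product_squarefree pa) //= -mdeg_mnm_set mnm_set_supp //.
  by rewrite (mdeg_edge_product pa).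
have -> : squarefree_pow (edge_ideal K G) p f <->
   ideal_gen (fun f => exists m, A m /\ f = 'X_[m]) f.
  split=> -[k [c [g [gA ->]]]]; exists k, c, g; split=> // l.
    by have [m [m1 m2 ->]] := gA l; exists m; split=> //; apply/AE.
  by have [m [/AE[m1 m2] ->]] := gA l; exists m.
rewrite monomial_idealP; split=> fA m /fA; first by case=> _ [U UA ->];
  exists U.
by case=> U UA Um; exists (mnm_set U) => //; exists U.
Qed.
End MonomialIdeals.

(** * Syzygies of a disconnected multidegree *)

Section Coefficients.
Variables (K : fieldType) (n : nat).
Local Open Scope ring_scope.
Notation S := {mpoly K[n]}.
Implicit Types (a b : S) (m k : 'X_{1..n}) (V D : {set 'I_n}).

Lemma mcoeffXM m a k :
  ('X_[m] * a)@_k = if (m <= k)%MM then a@_(k - m) else 0.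
Proof.
rewrite mulrC; case: ifP => [mk|/negP mk];
  first by rewrite -{1}(submK mk) addmC mcoeffMX.
apply: memN_msupp_eq0; apply/negP => /msuppM_le/allpairsP[[m1 m2] /= [_]].
by rewrite msuppX inE => /eqP-> kE; apply: mk; rewrite kE lem_addl.
Qed.

Lemma mcoeffXM_set i a D :
  ('X_i * a)@_(mnm_set D) = if i \in D then a@_(mnm_set (D :\ i)) else 0.
Proof.
by rewrite mcoeffXM -mnm_set1 mnm_set_leq sub1set; case: ifP => // iD;
   rewrite mnm_setB ?sub1set.
Qed.

(** Divisors of a squarefree monomial are squarefree, so the convolution runs over subsets of
    [V]. *)
Lemma mcoeffM_set b a V :
  (b * a)@_(mnm_set V) =
  \sum_(E : {set 'I_n} | E \subset V) b@_(mnm_set E) * a@_(mnm_set (V :\: E)).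
Proof.
elim/mpolyind: b => [|c m b _ _ IHb].
  by rewrite mul0r mcoeff0 big1 // => E _; rewrite mcoeff0 mul0r.
rewrite mulrDl mcoeffD IHb -scalerAl mcoeffZ mcoeffXM.
under [RHS]eq_bigr => E _ do rewrite mcoeffD mcoeffZ mulrDl -mulrA.
rewrite big_split -mulr_sumr; congr (_ * _ + _).
case: (boolP (m <= mnm_set V)%MM) => mV.
  have mE : m = mnm_set (mnm_supp m).
    rewrite mnm_set_supp // => i; apply: leq_trans (mnm_lepP mV i) _.
    exact: mnm_set_squarefree.
  have sV : mnm_supp m \subset V by rewrite -mnm_set_leq -mE.
  rewrite (bigD1 (mnm_supp m)) //= big1 => [|E /andP[_ Em]].
    by rewrite -mE mcoeffX eqxx mul1r addr0 -mnm_setB // -mE.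
  rewrite mcoeffX mE (inj_eq (@mnm_set_inj n)) eq_sym.
  by rewrite mE mnm_setK in Em; rewrite (negPf Em) mul0r.
rewrite big1 // => E EV; rewrite mcoeffX; case: eqVneq => [mE|];
  last by rewrite mul0r.
by rewrite mE mnm_set_leq EV in mV.
Qed.
End Coefficients.

Section Obstruction.
Variables (K : fieldType) (n : nat).
Local Open Scope ring_scope.
Notation S := {mpoly K[n]}.
Variables (A W : {set 'I_n}) (I : S -> Prop).
Hypothesis AW : A \subset W.
Hypothesis I0 : forall (f : S) (V : {set 'I_n}) i j, I f -> i \in A ->
  j \in W :\: A ->
  V \subset W :\: [set i; j] -> f@_(mnm_set V) = 0.

(* Sends a syzygy of multidegree [W] to the sum, over [i] in [A], of the
   Koszul component at the variable [i]. *)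
Let koszul (b a : S) : K := \sum_(D : {set 'I_n} | (D \subset A) && (D != set0))
  b@_(mnm_set D) * a@_(mnm_set (W :\: D)).

Let koszul_sum (J : finType) (b : J -> S) a :
  koszul (\sum_k b k) a = \sum_k koszul (b k) a.
Proof.
rewrite exchange_big; apply: eq_bigr => D _.
by rewrite raddf_sum mulr_suml.
Qed.

Let koszulB b b' a : koszul (b - b') a = koszul b a - koszul b' a.
Proof. by rewrite -sumrB; apply: eq_bigr => D _; rewrite mcoeffB mulrBl. Qed.

Let koszulD b b' a : koszul (b + b') a = koszul b a + koszul b' a.
Proof. by rewrite -big_split; apply: eq_bigr => D _;
  rewrite mcoeffD mulrDl. Qed.

Let koszulZ c b a : koszul (c *: b) a = c * koszul b a.
Proof. by rewrite mulr_sumr; apply: eq_bigr => D _; rewrite mcoeffZ mulrA. Qed.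

(** For [i] in [A], the substitution [D = i |: E] gives the terms of [(b * a)] at [W :\ i] with [E]
    inside [A]. If [E] contains some [j] outside [A], then [W :\ i :\: E] avoids [i] and [j], and
    [I0] kills the term. For [i] outside [A], the variable divides no monomial of a subset of
    [A]. *)
Let koszulX i b a : I a ->
  koszul ('X_i * b) a = if i \in A then (b * a)@_(mnm_set (W :\ i)) else 0.
Proof.
move=> Ia; rewrite /koszul; case: ifP => iA; last first.
  rewrite big1 // => D /andP[DA _]; rewrite mcoeffXM_set.
  by case: ifP => [/(subsetP DA)|_]; rewrite ?iA ?mul0r.
rewrite mcoeffM_set [RHS](bigID (fun E : {set _} => E \subset A)) /=.
rewrite [X in _ + X]big1 ?addr0 => [|E /andP[EW /subsetPn[j jE jA]]];
  last first.
  have /setD1P[ji jW] := subsetP EW _ jE.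
  rewrite (I0 (i := i) (j := j) Ia) ?mulr0 // ?inE ?jA //.
  apply/subsetP=> z; rewrite !inE => /and3P[zE zi ->].
  by rewrite (negPf zi) /= andbT; apply: contra zE => /eqP->.
rewrite [LHS](bigID (fun D : {set _} => i \in D)) /=.
rewrite [X in _ + X]big1 ?addr0 => [|D /andP[_ iD]]; last first.
  by rewrite mcoeffXM_set (negPf iD) mul0r.
rewrite (reindex_onto (fun E => i |: E) (fun D => D :\ i)) /=; last first.
  by move=> D /andP[_ iD]; rewrite setD1K.
have iE E : ((i |: E) :\ i == E) = (i \notin E).
  by apply/eqP/idP => [<-|/setU1K//]; rewrite setD11.
apply: eq_big => [E|E].
  have -> : i |: E != set0 by apply/set0Pn; exists i; apply: setU11.
  rewrite setU11 !andbT subUset sub1set iA iE subsetD1 /= andbC.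
  case: (boolP (E \subset A)) => EA; last by rewrite !andbF.
  by rewrite (subset_trans EA AW) !andbT.
by case/andP=> _ /eqP Ei; rewrite mcoeffXM_set setU11 Ei setDDl.
Qed.

Lemma no_disconnected_syzygy (F : free_seq K n) u v :
  graded F -> resolves F I -> u \in A -> v \in W :\: A ->
  I 'X_[mnm_set (W :\ u)] -> I 'X_[mnm_set (W :\ v)] ->
  exists k : 'I_(rk F 1), shift k = #|W|.
Proof.
move=> [aug_hom diff_hom] [augE diffE _] uA vWA.
move/augE=> [au auE] /augE[av avE].
have vA : v \notin A by case/setDP: vWA.
have vW : v \in W by case/setDP: vWA.
have aug_I l : I (aug F l 0).
  apply/augE; exists (delta_mx 0 l); rewrite -rowE mxE //.
have [k /eqP kW|nW] := pickP (fun k : 'I_(rk F 1) => shift k == #|W|).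
  by exists k.
pose phi (w : 'rV[S]_(rk F 0)) := \sum_l koszul (w 0 l) (aug F l 0).
(* On multiples of a variable, [phi] depends only on the image under [aug], so it vanishes on
   variable multiples of syzygies. *)
have phiX i w : phi ('X_i *: w) =
    if i \in A then ((w *m aug F) 0 0)@_(mnm_set (W :\ i)) else 0.
  rewrite /phi; under eq_bigr => l _ do rewrite mxE koszulX //.
  by case: ifP => _; [rewrite mxE raddf_sum|rewrite big1].
have phi_sum (J : finType) (w : J -> 'rV_(rk F 0)) :
  phi (\sum_k w k) = \sum_k phi (w k).
  rewrite exchange_big; apply: eq_bigr => l _.
  by rewrite summxE koszul_sum.
have syz : ('X_u *: au - 'X_v *: av) *m aug F = 0.
  apply/matrixP=> i j; rewrite !ord1 mulmxBl -!scalemxAl.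
  rewrite [LHS]mxE [X in X + _]mxE [X in _ + X]mxE [X in _ - X]mxE auE avE.
  rewrite -!mpolyXD -!mnm_set1 -!mnm_setU ?disjoints1 ?setD11 // !setD1K //.
    by rewrite subrr mxE.
  exact: (subsetP AW).
have [y yE] := (diffE _).1 syz.
(* A nonzero term needs [#|D| = shift k - shift l] and [#|W :\: D| = shift l], hence
   [shift k = #|W|], which is excluded. *)
have phi_row k : phi (row k (diff F 0)) = 0.
  apply: big1 => l _; apply: big1 => D /andP[DA _]; rewrite mxE.
  have := diff_hom 0 k l; case: leqP => [lek|_ /eqP->];
    last by rewrite mcoeff0 mul0r.
  move=> hd; case: (eqVneq #|D| (shift k - shift l)%N) => [cD|nD]; last first.
    have mD : mdeg (mnm_set D) != (shift k - shift l)%N by rewrite mdeg_mnm_set.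
    by rewrite (dhomog_nemf_coeff hd mD) mul0r.
  have mWD : mdeg (mnm_set (W :\: D)) != shift l.
    rewrite mdeg_mnm_set; apply/eqP => cWD; have /eqP := nW k; apply.
    have := cardsID D W; rewrite (setIidPr (subset_trans DA AW)).
    by rewrite cD cWD subnK.
  by rewrite (dhomog_nemf_coeff (aug_hom l) mWD) mulr0.
(* A nonconstant monomial splits off a variable, and [phiX] applies to the remaining multiple, still
   a syzygy. *)
have phi_mon k m : phi ('X_[m] *: row k (diff F 0)) = 0.
  case: (eqVneq m 0%MM) => [->|]; first by rewrite mpolyX0 scale1r.
  rewrite -mdeg_eq0 mdegE sum_nat_eq0 negb_forall => /existsP[i] /=.
  rewrite -lep1mP => im; rewrite -(submK im) addmC mpolyXD -scalerA phiX.
  have -> : ('X_[m - U_(i)] *: row k (diff F 0)) *m aug F = 0.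
    apply/diffE; exists ('X_[m - U_(i)] *: delta_mx 0 k).
    by rewrite -scalemxAl rowE.
  by rewrite mxE mcoeff0 if_same.
have phi_multiple p k : phi (p *: row k (diff F 0)) = 0.
  elim/mpolyind: p => [|c m p _ _ IHp].
    by rewrite scale0r; apply: big1 => l _; rewrite mxE; apply: big1 => D _;
      rewrite mcoeff0 mul0r.
  have -> : phi ((c *: 'X_[m] + p) *: row k (diff F 0)) =
     c * phi ('X_[m] *: row k (diff F 0)) + phi (p *: row k (diff F 0)).
    rewrite mulr_sumr -big_split; apply: eq_bigr => l _.
    by rewrite !mxE mulrDl koszulD -scalerAl koszulZ.
  by rewrite phi_mon mulr0 add0r.
(* Since [v] is outside [A], only [u] contributes: the coefficient of [x^(W :\ u)] in itself. *)
have : phi ('X_u *: au - 'X_v *: av) = 1.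
  have -> : phi ('X_u *: au - 'X_v *: av) = phi ('X_u *: au) - phi ('X_v *: av).
    by rewrite -sumrB; apply: eq_bigr => l _; rewrite -koszulB !mxE.
  by rewrite !phiX uA (negPf vA) subr0 auE mcoeffX eqxx.
rewrite -yE mulmx_sum_row phi_sum big1 => [/esym/eqP|k _];
  last exact: phi_multiple.
by rewrite oner_eq0.
Qed.

End Obstruction.

(** * Squarefree minimal resolutions *)

Section LabelledMatrices.
Variables (K : fieldType) (n : nat).
Local Open Scope ring_scope.
Notation labels r := ('I_r -> {set 'I_n}).
Implicit Types (V W : {set 'I_n}).

(** Its row space is spanned by the basis vectors with label inside [W], so being supported in [W]
    is an inclusion of row spaces. *)
Definition label_mask r (deg : labels r) (W : {set 'I_n}) : 'M[K]_r :=
  diag_mx (\row_k (deg k \subset W)%:R).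

Lemma sub_label_maskP r (deg : labels r) W (v : 'rV[K]_r) :
  reflect (forall k, v 0 k != 0 -> deg k \subset W) (v <= label_mask deg W)%MS.
Proof.
apply: (iffP submxP) => [[w ->] k|vW].
  by rewrite mul_mx_diag !mxE; case: (_ \subset _); rewrite // mulr0 eqxx.
exists v; apply/rowP=> k; rewrite mul_mx_diag !mxE.
have [->|/vW ->] := eqVneq (v 0 k) 0; by rewrite (mul0r, mulr1).
Qed.

Lemma label_mask_id r (deg : labels r) W (v : 'rV[K]_r) :
  (v <= label_mask deg W)%MS -> v *m label_mask deg W = v.
Proof.
move/sub_label_maskP => vW; apply/rowP=> k; rewrite mul_mx_diag !mxE.
have [->|/vW ->] := eqVneq (v 0 k) 0; by rewrite (mul0r, mulr1).
Qed.

Lemma label_maskS r (deg : labels r) (V W : {set 'I_n}) :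
  V \subset W -> (label_mask deg V <= label_mask deg W)%MS.
Proof.
move=> VW; apply/row_subP=> k; apply/sub_label_maskP => l; rewrite !mxE.
case: (eqVneq k l) => [<-|]; last by rewrite mulr0n eqxx.
by case: (boolP (deg k \subset V)) => [/subset_trans->//|]; rewrite mul0rn eqxx.
Qed.

Section Kernel.
Variables (r1 r0 : nat) (deg : labels r1) (d : 'M[K]_(r1, r0)).

(** With the variables set to 1, the part of a free module in multidegree [W] becomes the span of
    the basis vectors with label inside [W]. Then [new_ker W] represents the minimal syzygies of
    multidegree [W]: a complement to those coming from smaller multidegrees. *)
Definition label_ker W : 'M[K]_r1 := (kermx d :&: label_mask deg W)%MS.
Definition lower_ker W : 'M[K]_r1 := (\sum_(V :
  {set 'I_n} | V \proper W) label_ker V)%MS.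
Definition new_ker W : 'M[K]_r1 := (label_ker W :\: lower_ker W)%MS.

Lemma sub_label_ker W (v : 'rV[K]_r1) :
  (v <= label_ker W)%MS = (v *m d == 0) && (v <= label_mask deg W)%MS.
Proof. by rewrite sub_capmx sub_kermx. Qed.

Lemma label_kerS (V W : {set 'I_n}) : V \subset W ->
  (label_ker V <= label_ker W)%MS.
Proof. by move=> VW; apply: capmxS => //; apply: label_maskS. Qed.

Lemma label_ker_lower V W : V \proper W -> (label_ker V <= lower_ker W)%MS.
Proof. by move=> VW; apply: (sumsmx_sup V). Qed.

(* No homogeneous syzygy of label [W] involves a generator of label [W]: the
   generators are minimal. *)
Definition reduced : Prop :=
  forall W (v : 'rV[K]_r1), (v <= label_ker W)%MS ->
  forall k, deg k = W -> v 0 k = 0.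

Definition next_index := {W : {set 'I_n} & 'I_(\rank (new_ker W))}.
Definition next_rank := #|{: next_index}|.
Definition next_deg (k : 'I_next_rank) : {set 'I_n} := tag (enum_val k).
Definition next_mx : 'M[K]_(next_rank, r1) :=
  \matrix_k row (tagged (enum_val k)) (row_base (new_ker (tag (enum_val k)))).

Lemma next_mx_new k : (row k next_mx <= new_ker (next_deg k))%MS.
Proof. by rewrite rowK (submx_trans (row_sub _ _)) // eq_row_base. Qed.

Lemma next_mx_ker k : (row k next_mx <= label_ker (next_deg k))%MS.
Proof. exact: submx_trans (next_mx_new k) (diffmxSl _ _). Qed.

Lemma next_mx_proper k l :
  reduced -> next_mx k l != 0 -> deg l \proper next_deg k.
Proof.
move=> red kl; rewrite properEneq.
have kerk := next_mx_ker k; have kl' : row k next_mx 0 l != 0 by rewrite mxE.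
apply/andP; split; first by apply: contraNneq kl' => /(red _ _ kerk) ->.
by move: kerk; rewrite sub_label_ker => /andP[_ /sub_label_maskP]; apply.
Qed.

(** Induction on [#|W|]: [label_ker W] is spanned by [new_ker W], whose basis consists of rows of
    [next_mx], and by a part of [lower_ker W], reached in smaller multidegrees. *)
Lemma next_mx_exact W : (label_mask next_deg W *m next_mx :=: label_ker W)%MS.
Proof.
apply/eqmxP/andP; split.
  apply/row_subP=> k; rewrite row_mul row_diag_mx mxE -scalemxAl -rowE.
  case: (boolP (next_deg k \subset W)) => [kW|_];
    last by rewrite scale0r sub0mx.
  by rewrite scale1r (submx_trans (next_mx_ker k)) // label_kerS.
have [m] := ubnP #|W|; elim: m W => // m IHm W; rewrite ltnS => Wm.
rewrite -(addsmx_diff_cap_eq _ (lower_ker W)) addsmx_sub; apply/andP; split.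
  rewrite -(eq_row_base (new_ker W)); apply/row_subP => i.
  pose k : 'I_next_rank := enum_rank (Tagged _ i : next_index).
  have kW : next_deg k = W by rewrite /next_deg enum_rankK.
  apply/submxP; exists (delta_mx 0 k).
  rewrite mulmxA -[delta_mx 0 k *m _]rowE row_diag_mx mxE kW subxx scale1r
    -rowE.
  by rewrite rowK /k enum_rankK.
apply: submx_trans (capmxSr _ _) _; apply/sumsmx_subP => V VW.
apply: submx_trans (IHm _ _) _; first exact: leq_trans (proper_card VW) Wm.
apply: submxMr; apply: label_maskS; exact: proper_sub.
Qed.

Lemma sum_next_mx (v : 'rV[K]_next_rank) :
  v *m next_mx = \sum_W \sum_(i < \rank (new_ker W))
    v 0 (enum_rank (Tagged _ i : next_index)) *: row i (row_base (new_ker W)).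
Proof.
rewrite sig_big_dep /= mulmx_sum_row.
rewrite [RHS](reindex _ (onW_bij _ (@enum_val_bij next_index))) /=.
apply: eq_bigr => k _; rewrite rowK.
have -> : Tagged _ (tagged (enum_val k)) = enum_val k :> next_index.
  by case: (enum_val k).
by rewrite enum_valK.
Qed.
End Kernel.

(** In a relation of label [W], the part [u] on generators of label exactly [W] lies in [new_ker W],
    and the remaining terms put it in [lower_ker W]. So [u = 0], and freeness of the basis of
    [new_ker W] kills its coefficients. *)
Lemma next_reduced r1 r0 (deg : labels r1) (d : 'M[K]_(r1, r0)) :
  reduced (@next_deg _ _ deg d) (next_mx deg d).
Proof.
move=> W v; rewrite sub_label_ker => /andP[/eqP vd /sub_label_maskP vW] k kW.
move: vd; rewrite sum_next_mx (bigD1 W) //=; set u := \sum_(i < _) _.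
move=> /eqP; rewrite addr_eq0 => /eqP uE.
have uN : (u <= new_ker deg d W)%MS.
  by apply: summx_sub => i _;
    rewrite scalemx_sub // -(eq_row_base (new_ker _ _ W)) row_sub.
have uL : (u <= lower_ker deg d W)%MS.
  rewrite uE eqmx_opp; apply: summx_sub => V VW; apply: summx_sub => i _.
  have [->|/vW] := eqVneq (v 0 (enum_rank (Tagged _ i : next_index deg d))) 0.
    by rewrite scale0r sub0mx.
  rewrite /next_deg enum_rankK /= => sVW; rewrite scalemx_sub //.
  have pVW : V \proper W by rewrite properEneq VW.
  apply: (submx_trans _ (label_ker_lower _ _ pVW)).
  by rewrite (submx_trans (row_sub _ _)) // eq_row_base diffmxSl.
have u0 : u = 0.
  by apply/eqP; rewrite -submx0 -(capmx_diff (label_ker deg d W) (lower_ker deg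
    d W)) sub_capmx uN.
pose u' : 'rV_(\rank (new_ker deg d W)) := \row_i v 0 (enum_rank (Tagged _ i :
  next_index deg d)).
have : u' = 0.
  apply/eqP; rewrite -(mulmx_free_eq0 _ (row_base_free (new_ker deg d W))).
  rewrite mulmx_sum_row; apply/eqP; rewrite -[RHS]u0; apply: eq_bigr => i _.
  by rewrite mxE.
rewrite /u' {u' u uE uN uL u0}; subst W.
move=> /rowP/(_ (tagged (enum_val k))); rewrite !mxE.
have -> : Tagged _ (tagged (enum_val k)) = enum_val k :> next_index deg d.
  by case: (enum_val k).
by rewrite enum_valK.
Qed.
End LabelledMatrices.

(** * Lifting labelled matrices to the polynomial ring *)

Section Lifting.
Variables (K : fieldType) (n : nat).
Local Open Scope ring_scope.
Notation labels r := ('I_r -> {set 'I_n}).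
Notation S := {mpoly K[n]}.
Implicit Types (b m : 'X_{1..n}).

(* The part of [v] in multidegree [b], the [k]-th basis vector being in
   multidegree [mnm_set (deg k)]; the monomial, determined by [b] and [k], is
   dropped. *)
Definition component r (deg : labels r) (v : 'rV[S]_r) b : 'rV[K]_r :=
  \row_k (if (mnm_set (deg k) <= b)%MM then (v 0 k)@_(b - mnm_set (deg k)) else
    0).

Lemma component_inj r (deg : labels r) (v v' : 'rV[S]_r) :
  component deg v =1 component deg v' -> v = v'.
Proof.
move=> vv'; apply/rowP=> k; apply/mpolyP => m.
have /rowP/(_ k) := vv' (m + mnm_set (deg k))%MM.
by rewrite !mxE lem_addl addmK.
Qed.

Lemma component0 r (deg : labels r) b : component deg 0 b = 0.
Proof. by apply/rowP=> k; rewrite !mxE mcoeff0 if_same. Qed.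

Lemma component_mask r (deg : labels r) v b :
  (component deg v b <= label_mask K deg (mnm_supp b))%MS.
Proof.
by apply/sub_label_maskP => k; rewrite mxE mnm_set_le; case: ifP; rewrite ?eqxx.
Qed.

Section Lift.
Variables (r1 r0 : nat) (deg1 : labels r1) (deg0 : labels r0) (d :
  'M[K]_(r1, r0)).

(** The homogenization of [d]. The truncated subtraction of exponents is exact at nonzero entries
    once [label_compatible] holds. *)
Definition lift_mx : 'M[S]_(r1, r0) :=
  \matrix_(k, l) (d k l *: 'X_[mnm_set (deg1 k) - mnm_set (deg0 l)]).

Definition label_compatible := forall k l, d k l != 0 -> deg0 l \subset deg1 k.
Hypothesis dC : label_compatible.

(** Monomial entries only shift exponents, so the lifted map is [d] in every multidegree. This
    reduces exactness over [S] to linear algebra over [K]. *)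
Lemma component_lift v b :
  component deg0 (v *m lift_mx) b = component deg1 v b *m d.
Proof.
apply/rowP=> l; rewrite !mxE raddf_sum.
have -> (c : bool) (F : 'I_r1 -> K) :
   (if c then \sum_k F k else 0) = \sum_k (if c then F k else 0).
  by case: c; rewrite // big1.
apply: eq_bigr => k _; rewrite !mxE /=.
have [->|/dC lk] := eqVneq (d k l) 0.
  by rewrite scale0r !mulr0 mcoeff0 if_same.
rewrite -scalerAr mcoeffZ [_ * 'X_[_]]mulrC mcoeffXM mulrC.
have lek : (mnm_set (deg0 l) <= mnm_set (deg1 k))%MM by rewrite mnm_set_leq.
case: (boolP (mnm_set (deg1 k) <= b)%MM) => kb; last first.
  rewrite mul0r; case: ifP => // lb.
  rewrite ifF ?mul0r //; apply: contraNF kb => /mnm_lepP kb.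
  apply/mnm_lepP=> i; have := kb i; have := mnm_lepP lek i;
    have := mnm_lepP lb i.
  by rewrite !mnmBE; lia.
rewrite (lepm_trans lek kb) ifT; last first.
  by apply/mnm_lepP=> i; rewrite !mnmBE leq_sub2r ?(mnm_lepP kb).
congr (_@_ _ * _); apply/mnmP=> i; rewrite !mnmBE.
by have := mnm_lepP kb i; have := mnm_lepP lek i; lia.
Qed.

Lemma lift_kerP v :
  v *m lift_mx = 0 <->
  forall b, (component deg1 v b <= label_ker deg1 d (mnm_supp b))%MS.
Proof.
split=> [vd b|vd].
  by rewrite sub_label_ker component_mask -component_lift vd component0 eqxx.
apply: (@component_inj _ deg0) => b; rewrite component_lift component0.
by have := vd b; rewrite sub_label_ker => /andP[/eqP].
Qed.

Lemma lift_imageP v :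
  (exists w, w *m lift_mx = v) <->
  forall b, (component deg0 v b <= label_mask K deg1 (mnm_supp b) *m d)%MS.
Proof.
split=> [[w <-] b|vd].
  rewrite component_lift -[component _ _ _](label_mask_id (component_mask _ _
    _)).
  by rewrite -mulmxA submxMl.
(* A preimage in each multidegree, supported on the labels inside [mnm_supp b]. *)
pose c b : 'rV[K]_r1 := component deg0 v b *m
  pinvmx (label_mask K deg1 (mnm_supp b) *m d) *m label_mask K deg1 (mnm_supp
    b).
have cd b : c b *m d = component deg0 v b by rewrite -mulmxA mulmxKpV.
have c_mask b : (c b <= label_mask K deg1 (mnm_supp b))%MS by exact: submxMl.
(* The finitely many multidegrees occurring in [v], each listed once, so that the preimages can be
   summed. *)
pose B := undup (flatten
  [seq [seq (m + mnm_set (deg0 l))%MM | m <- msupp (v 0 l)] | l <- enum 'I_r0]).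
have cB b : b \notin B -> c b = 0.
  move=> bB; rewrite /c; suff -> : component deg0 v b = 0 by rewrite !mul0mx.
  apply/rowP=> l; rewrite !mxE; case: ifP => // lb.
  apply: memN_msupp_eq0; apply: contra bB => mb; rewrite mem_undup.
  apply/flattenP; eexists; first by apply: map_f; rewrite mem_enum.
  by rewrite -(submK lb); apply: map_f.
clearbody c.
exists (\row_k \sum_(b <- B) (if (mnm_set (deg1 k) <= b)%MM
    then c b 0 k *: 'X_[b - mnm_set (deg1 k)] else 0)).
apply: (@component_inj _ deg0) => b; rewrite component_lift -cd; congr (_ *m _).
apply/rowP=> k; rewrite !mxE; case: ifP => kb; last first.
  apply/esym/eqP; apply: contraFT kb => ck.
  by move/sub_label_maskP: (c_mask b) => cb; rewrite mnm_set_le; apply: cb.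
rewrite raddf_sum /=.
have term b' : (if (mnm_set (deg1 k) <= b')%MM
    then c b' 0 k *: 'X_[b' - mnm_set (deg1 k)] else 0)@_(b - mnm_set (deg1 k))
  = if b' == b then c b 0 k else 0.
  case: ifP => kb'; last by rewrite mcoeff0; case: eqP kb' => // ->; rewrite kb.
  rewrite mcoeffZ mcoeffX -(eqm_add2r (mnm_set (deg1 k))) !submK //.
  by case: eqP => [->|_]; rewrite (mulr1, mulr0).
under eq_bigr => b' _ do rewrite term.
case: (boolP (b \in B)) => bB; last first.
  rewrite (cB b bB) mxE big1_seq // => b' _; by rewrite if_same.
rewrite (bigD1_seq b) ?undup_uniq //= eqxx big1 ?addr0 // => b' /negPf->.
by [].
Qed.
End Lift.

Lemma lift_exact r1 r0 (deg1 : labels r1) (deg0 : labels r0) (d :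
  'M[K]_(r1, r0))
    (v : 'rV[S]_r1) :
  label_compatible deg1 deg0 d ->
  label_compatible (@next_deg _ _ _ _ deg1 d) deg1 (next_mx deg1 d) ->
  v *m lift_mx deg1 deg0 d = 0 <->
  exists w, w *m lift_mx (@next_deg _ _ _ _ deg1 d) deg1 (next_mx deg1 d) = v.
Proof.
move=> dC nC; rewrite lift_kerP // lift_imageP //.
by split=> H b; have := H b; rewrite next_mx_exact.
Qed.

Record stage := Stage {
  st_rank0 : nat;
  st_deg0 : labels st_rank0;
  st_rank1 : nat;
  st_deg1 : labels st_rank1;
  st_mx : 'M[K]_(st_rank1, st_rank0)
}.

Definition next_stage (s : stage) : stage :=
  Stage (@st_deg1 s) (@next_deg _ _ _ _ (@st_deg1 s) (st_mx s))
    (next_mx (@st_deg1 s) (st_mx s)).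

Definition good_stage (s : stage) : Prop :=
  label_compatible (@st_deg1 s) (@st_deg0 s) (st_mx s) /\
  reduced (@st_deg1 s) (st_mx s).

Lemma next_stage_proper (s : stage) k l :
  good_stage s -> st_mx (next_stage s) k l != 0 ->
  st_deg0 l \proper st_deg1 k.
Proof. by case=> _; apply: next_mx_proper. Qed.

Lemma good_next_stage s : good_stage s -> good_stage (next_stage s).
Proof.
move=> gs; split; last exact: next_reduced.
by move=> k l /(next_stage_proper gs)/proper_sub.
Qed.

(** * Resolving a squarefree monomial ideal generated in one degree *)

Section Resolution.
Variables (r : nat) (deg : labels r) (t : nat).
Local Notation ones := (const_mx 1 : 'M[K]_(r, 1)).
Hypotheses (deg_inj : injective deg) (card_deg : forall k, #|deg k| = t).

Definition aug_label (_ : 'I_1) : {set 'I_n} := set0.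

(** Stage 0 is the augmentation: the all-ones column over one generator of label [set0] lifts to the
    column of monomial generators. Hence differential [i] is read off stage [i + 1]. *)
Definition stages i : stage :=
  iter i next_stage (Stage aug_label deg (const_mx 1)).

Definition squarefree_resolution : free_seq K n :=
  @FreeSeq K n (fun i => st_rank1 (stages i))
    (fun i k => #|st_deg1 (s := stages i) k|)
    (fun i => lift_mx (@st_deg1 (stages i.+1)) (@st_deg0 (stages i.+1)) (st_mx
      (stages i.+1)))
    (lift_mx deg aug_label (const_mx 1)).

(** At stage 0, distinct labels of equal size are incomparable, so a kernel vector supported inside
    [deg k] has [k] as its only coordinate, and that coordinate is 0. *)
Lemma good_stages i : good_stage (stages i).
Proof.
elim: i => [|i]; last exact: good_next_stage.
split=> [k l _|W v]; first exact: sub0set.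
rewrite sub_label_ker => /andP[/eqP v1 /sub_label_maskP vW] k kW.
have /matrixP/(_ 0 0) := v1; rewrite !mxE (bigD1 k) //= mxE mulr1.
rewrite big1 ?addr0 // => l lk; rewrite mxE mulr1; apply: contraNeq lk => /vW.
rewrite -kW => lk; apply/eqP/deg_inj/eqP.
by rewrite eqEcard lk !card_deg leqnn.
Qed.

Lemma lift_mx_homog r1 r0 (deg1 : labels r1) (deg0 : labels r0) (d :
  'M[K]_(r1, r0)) k l :
  label_compatible deg1 deg0 d ->
  if (#|deg0 l| <= #|deg1 k|)%N
  then lift_mx deg1 deg0 d k l \is (#|deg1 k| - #|deg0 l|).-homog
  else lift_mx deg1 deg0 d k l == 0.
Proof.
move=> dC; rewrite mxE; have [->|/dC lk] := eqVneq (d k l) 0.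
  by rewrite scale0r eqxx dhomog0 if_same.
rewrite (subset_leq_card lk) dhomogZ // mnm_setB // dhomogX.
by apply/eqP; rewrite [LHS]mdeg_mnm_set cardsD (setIidPr lk).
Qed.

Lemma squarefree_resolution_graded : graded squarefree_resolution.
Proof.
split=> [k|i k l]; last exact: (lift_mx_homog k l (good_stages i.+1).1).
have := lift_mx_homog k 0 (good_stages 0).1.
by rewrite cards0 subn0.
Qed.

Lemma squarefree_resolution_minimal : minimal squarefree_resolution.
Proof.
move=> i k l; rewrite mxE mcoeffZ mcoeffX.
have [->|kl] := eqVneq (st_mx (stages i.+1) k l) 0; first by rewrite mul0r.
have := next_stage_proper (good_stages i) kl.
rewrite properE => /andP[lk kl']; rewrite mnm_setB // -mnm_set0.
by rewrite (inj_eq (@mnm_set_inj n)) setD_eq0 (negPf kl') mulr0.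
Qed.

Variable I : S -> Prop.
Hypothesis IE : forall f, I f <->
  forall m, m \in msupp f -> exists k, (mnm_set (deg k) <= m)%MM.

Lemma squarefree_resolution_resolves : resolves squarefree_resolution I.
Proof.
split=> [f|v|i v].
- have compE b : component aug_label (const_mx f) b = const_mx (f@_b).
    apply/rowP=> l; rewrite !mxE.
    by rewrite mnm_set_le sub0set mnm_set0 subm0.
  have -> : (exists v :
    'rV_r, (v *m lift_mx deg aug_label (const_mx 1)) 0 0 = f) <->
      exists v : 'rV_r, v *m lift_mx deg aug_label (const_mx 1) = const_mx f.
    split=> -[v vE]; exists v; last by rewrite vE mxE.
    by apply/matrixP=> i j; rewrite !ord1 vE mxE.
  rewrite IE (lift_imageP (good_stages 0).1); split=> [fI b|fI m mf].
    rewrite compE; have [->|fb] := eqVneq f@_b 0.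
      by rewrite -[const_mx 0]/(0 : 'M_1) sub0mx.
    have [|k] := fI b; first by rewrite mcoeff_msupp.
    rewrite mnm_set_le => kb; apply/submxP; exists (f@_b *: delta_mx 0 k).
    rewrite -scalemxAl mulmxA -[delta_mx 0 k *m _]rowE row_diag_mx mxE kb
      scale1r.
    by rewrite -rowE; apply/rowP=> j; rewrite !mxE mulr1.
  (* If no generator divides [m], the mask is zero, and so is the coefficient of [m] in [f]. *)
  apply/existsP; rewrite -[X in is_true X]negbK; apply/negP => /existsPn nk.
  have := fI m; rewrite compE.
  have -> : label_mask K deg (mnm_supp m) = 0.
    apply/matrixP=> k l; rewrite !mxE -mnm_set_le (negPf (nk k)).
    by rewrite mul0rn.
  rewrite mul0mx => /submx0null/matrixP/(_ 0 0); rewrite !mxE => fm.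
  by rewrite mcoeff_msupp fm eqxx in mf.
- exact: (lift_exact v (good_stages 0).1 (good_stages 1).1).
exact: (lift_exact v (good_stages i.+1).1 (good_stages i.+2).1).
Qed.

Lemma squarefree_resolutionP :
  minimal_graded_free_resolution squarefree_resolution I.
Proof.
split; [exact: squarefree_resolution_graded
       |exact: squarefree_resolution_resolves
       |exact: squarefree_resolution_minimal].
Qed.

(* Connectedness of the generators dividing [W] under the relation "their union
   is not [W]", expressed by quantifying over the preorders that contain it. *)
Definition linked (W : {set 'I_n}) : Prop :=
  forall E : {set 'I_n} -> {set 'I_n} -> Prop,
  (forall P, E P P) ->
  (forall P Q R, E P Q -> E Q R -> E P R) ->
  (forall k l, deg k :|: deg l \proper W -> E (deg k) (deg l)) ->
  forall k l, deg k \subset W -> deg l \subset W -> E (deg k) (deg l).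

(** Congruence of basis vectors modulo [lower_ker W] is a preorder containing the pairs whose union
    is strictly inside [W]. Hence [linked] puts in [lower_ker W] all differences of basis vectors
    with labels inside [W], and these span the kernel of the all-ones map there. *)
Lemma linked_ker (W : {set 'I_n}) : linked W ->
  (label_ker deg ones W <= lower_ker deg ones W)%MS.
Proof.
move=> lW; pose e (P : {set 'I_n}) : 'rV[K]_r := \row_k (deg k == P)%:R.
have eE k : e (deg k) = delta_mx 0 k.
  by apply/rowP=> l; rewrite !mxE (inj_eq deg_inj).
have {}lW k l : deg k \subset W -> deg l \subset W ->
    (e (deg k) - e (deg l) <= lower_ker deg ones W)%MS.
  pose E P Q : Prop := (e P - e Q <= lower_ker deg ones W)%MS.
  apply: (lW E) => [P|P Q R PQ QR|{}k {}l kl].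
    by rewrite /E subrr sub0mx.
    by rewrite /E -(subrKA (e Q)) addmx_sub.
  apply: submx_trans (label_ker_lower _ _ kl); rewrite sub_label_ker !eE.
  apply/andP; split.
    by rewrite mulmxBl -!rowE; apply/eqP/rowP=> j; rewrite !mxE subrr.
  rewrite addmx_sub ?eqmx_opp //; apply/sub_label_maskP => j;
    rewrite !mxE eqxx /=.
    by case: (eqVneq j k) => [-> _|_]; [apply: subsetUl|rewrite eqxx].
  by case: (eqVneq j l) => [-> _|_]; [apply: subsetUr|rewrite eqxx].
apply/rV_subP => v; rewrite sub_label_ker => /andP[/eqP v1 /sub_label_maskP vW].
have [->|] := eqVneq v 0; first by rewrite sub0mx.
(* The coefficients of [v] sum to zero, so any [l] in its support can serve as base point. *)
case/rV0Pn=> l vl; have -> : v = \sum_k v 0 k *: (e (deg k) - e (deg l)).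
  under eq_bigr => k _ do rewrite scalerBr eE.
  rewrite sumrB -row_sum_delta -scaler_suml.
  have -> : \sum_k v 0 k = 0.
    have /matrixP/(_ 0 0) := v1; rewrite !mxE => {2}<-.
    by apply: eq_bigr => k _; rewrite mxE mulr1.
  by rewrite scale0r subr0.
apply: summx_sub => k _.
have [->|/vW kW] := eqVneq (v 0 k) 0; first by rewrite scale0r sub0mx.
by rewrite scalemx_sub // lW // vW.
Qed.

Lemma squarefree_resolution_shift1 (k : 'I_(rk squarefree_resolution 1)) :
  exists2 W : {set 'I_n}, shift k = #|W| & ~ linked W.
Proof.
exists (st_deg1 (s := stages 1) k) => // /linked_ker.
move: k => /= k; rewrite /next_deg; case: (enum_val k) => W i /= kerW.
have : new_ker deg ones W = 0.
  apply/eqP; rewrite -submx0 -(capmx_diff (label_ker deg ones W)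
     (lower_ker deg ones W)).
  by rewrite sub_capmx submx_refl (submx_trans (diffmxSl _ _)).
move=> nW; move: i; rewrite nW mxrank0; by case.
Qed.

End Resolution.
End Lifting.

(** * Linearly related squarefree powers *)

Section LinearlyRelated.
Variables (K : fieldType) (n : nat) (G : sgraph 'I_n) (p : nat).
Local Open Scope ring_scope.
Notation S := {mpoly K[n]}.
Let I : S -> Prop := squarefree_pow (edge_ideal K G) p.

Lemma matched_squarefree_pow (U V : {set 'I_n}) :
  U \in matched_sets G p -> U \subset V -> I 'X_[mnm_set V].
Proof.
move=> Up UV; apply/squarefree_powP => m; rewrite msuppX inE => /eqP->.
by exists U; rewrite ?mnm_set_leq.
Qed.

(** [linearly_related] leaves the generating degree [t] open; this bound is enough to keep [2p + 2]
    different from [t + 1]. *)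
Lemma generated_degree_le (U : {set 'I_n}) t :
  generated_in_degree I t -> U \in matched_sets G p -> (t <= 2 * p)%N.
Proof.
move=> [A [homA genA]] Up; have UI := matched_squarefree_pow Up (subxx U).
have := (@msupp_ideal_gen _ _ A (fun m => t <= mdeg m)%N _ _ _ ((genA _).1 UI)
  (mnm_set U)).
rewrite msuppX inE eqxx mdeg_mnm_set; move: Up; rewrite inE => /andP[_ /eqP->].
apply=> // [m m'|f Af m mf]; first by rewrite mdegD; lia.
by have /dhomogP/(_ m mf) <- := homA f Af.
Qed.

Lemma linearly_related_connected (U : {set 'I_n}) :
  linearly_related I -> #|U| = (2 * p + 2)%N -> perfectly_matched G U ->
  connected (induced G U).
Proof.
move=> [t [gent betti]] cU mU; apply/connectedP; apply: contraT => /connectedP.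
case/not_connected_split => A [AU /set0Pn[u uA] /set0Pn[v vUA] sep].
have [vA vU] : v \notin A /\ v \in U by move: vUA; rewrite inE => /andP[].
have uU : u \in U by exact: (subsetP AU).
have /perfectly_matchedP[f Mf] := mU.
have Mp x : x \in U -> U :\: [set x; f x] \in matched_sets G p.
  move=> xU; rewrite inE (matches_remove x Mf) /=; apply/eqP.
  by have := card_matches_remove Mf xU; rewrite cU addn2 => -[].
have MI x : x \in U -> I 'X_[mnm_set (U :\ x)].
  by move=> xU; apply: matched_squarefree_pow (Mp x xU) _;
    rewrite setDS // sub1set set21.
have tp := generated_degree_le gent (Mp u uU).
have [|F [[grF resF _] noF]] := betti (2 * p + 2)%N; first lia.
(* A [p]-matching avoiding [i] and [j] would cover the rest of [U], hence perfectly match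
   [(U :\: A) :\ j]. That set is odd, because [U :\: A] is itself perfectly matched. *)
have I0 (h : S) (V : {set 'I_n}) i j : I h -> i \in A -> j \in U :\: A ->
    V \subset U :\: [set i; j] -> h@_(mnm_set V) = 0.
  move=> Ih iA jUA Vij; apply/eqP; apply: contraT; rewrite -mcoeff_msupp => Vh.
  have [P] := (squarefree_powP _ _ _).1 Ih _ Vh.
  rewrite inE mnm_set_leq => /andP[mP /eqP cP] PV.
  have [jA jU] : j \notin A /\ j \in U by move: jUA; rewrite inE => /andP[].
  have iU : i \in U by exact: (subsetP AU).
  have ij : i != j by apply: contraNneq jA => <-.
  have PE : P = U :\: [set i; j].
    apply/eqP; rewrite eqEcard (subset_trans PV Vij) cP.
    have sij : [set i; j] \subset U by rewrite subUset !sub1set iU.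
    have := cardsID [set i; j] U.
    by rewrite (setIidPr sij) cards2 ij cU [RHS]addnC => /addnI->;
      rewrite leqnn.
  have PA : P :\: (A :\ i) = (U :\: A) :\ j.
    apply/setP=> z; rewrite PE !inE.
    case: (eqVneq z i) => [->|_]; first by rewrite iA !andbF.
    by case: (eqVneq z j) => [->|_]; rewrite ?andbF.
  have /perfectly_matched_even oddUA := perfectly_matched_side sep AU mU.
  have : ~~ odd #|P :\: (A :\ i)|.
    apply: perfectly_matched_even; apply: perfectly_matched_side mP.
      by move=> x y /setD1P[_ xA]; rewrite PA => /setD1P[_ yUA]; apply: sep.
    apply/subsetP=> z /setD1P[zi zA];
      rewrite PE !inE negb_or zi (subsetP AU) // andbT.
    by apply: contraNneq jA => <-.
  by rewrite PA; move: oddUA; rewrite (cardsD1 j) jUA add1n /= negbK => ->.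
have [k kU] := no_disconnected_syzygy AU I0 grF resF uA vUA (MI u uU) (MI v vU).
move/eqP: noF; rewrite cards_eq0 => /eqP/setP/(_ k).
by rewrite !inE kU cU eqxx.
Qed.

Lemma connected_linearly_related :
  (forall U : {set 'I_n}, #|U| = (2 * p + 2)%N -> perfectly_matched G U ->
    connected (induced G U)) ->
  linearly_related I.
Proof.
move=> conn; exists (2 * p)%N; split.
  exists (fun f => exists m, (exists2 U, U \in matched_sets G p &
    m = mnm_set U) /\ f = 'X_[m]).
  split=> [_ [_ [[U Up ->] ->]]|f].
    rewrite dhomogX; apply/eqP; rewrite [LHS]mdeg_mnm_set.
    by move: Up; rewrite inE => /andP[_ /eqP].
  rewrite /I monomial_idealP squarefree_powP; split=> fI m /fI.
    by case=> U Up Um; exists (mnm_set U) => //; exists U.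
  by case=> _ [U Up ->] Um; exists U.
pose deg (k : 'I_#|matched_sets G p|) : {set 'I_n} := enum_val k.
have degP k : perfectly_matched G (deg k) /\ #|deg k| = (2 * p)%N.
  by have := enum_valP k; rewrite inE => /andP[? /eqP].
have IE f : I f <-> forall m, m \in msupp f ->
  exists k, (mnm_set (deg k) <= m)%MM.
  rewrite /I squarefree_powP; split=> fI m /fI => [[U Up Um]|[k km]].
    by exists (enum_rank_in Up U); rewrite /deg enum_rankK_in.
  by exists (deg k) => //; apply: enum_valP.
move=> j jt; exists (squarefree_resolution K deg); split.
  apply: (@squarefree_resolutionP K n _ deg (2 * p)%N) => //;
    first exact: enum_val_inj.
  by move=> k; have [] := degP k.
apply/eqP; rewrite cards_eq0; apply/eqP/setP=> k; rewrite !inE.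
apply/eqP=> kj; have [|W kW] := squarefree_resolution_shift1 _ k;
  first exact: enum_val_inj.
apply=> E Erefl Etrans E1 i l iW lW.
have [mi ci] := degP i; have [ml cl] := degP l.
(* In a set of size at most [2p] the only possible label is the set itself, so reflexivity
   suffices. *)
have [leW|ltW] := leqP #|W| (2 * p)%N.
  have dW i' : deg i' \subset W -> deg i' = W.
    by move=> sW; apply/eqP; rewrite eqEcard sW; have [_ ->] := degP i'.
  by rewrite (dW i) // (dW l).
apply: (perfectly_matched_linked Etrans _ _ _ mi ml ci cl iW lW).
- move=> P Q mP mQ cP cQ PQ.
  have Pp : P \in matched_sets G p by rewrite inE mP cP eqxx.
  have Qp : Q \in matched_sets G p by rewrite inE mQ cQ eqxx.
  have := E1 (enum_rank_in Pp P) (enum_rank_in Qp Q).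
  by rewrite /deg !enum_rankK_in //; apply.
- by move=> cW; apply: conn; lia.
(* The linear degree [2p + 1] is excluded by [jt], which leaves [#|W|] at least [2p + 2]. *)
by move: jt ltW; rewrite -kj kW; lia.
Qed.
End LinearlyRelated.

Theorem theorem0p1 (K : fieldType) (n : nat) (G : sgraph 'I_n) (p : nat)
    (hp2 : 2 <= p) (hpnu : p <= matching_number G) :
  linearly_related (squarefree_pow (edge_ideal K G) p) <->
  ~ (exists U : {set 'I_n},
       [/\ #|U| = 2 * p + 2,
           ~ connected (induced G U)
         & matching_number (induced G U) = p.+1]).
Proof.
have cardE (U : {set 'I_n}) : #|U| = 2 * p + 2 -> #|U| = p.+1 * 2 by lia.
split=> [lin [U [cU nc mU]]|noU].
  apply: nc; apply: (linearly_related_connected lin cU).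
  by apply/(matching_number_induced G (cardE U cU)).
apply: connected_linearly_related => U cU mU.
apply/connectedP; apply: contraT => /connectedP nc; case: noU; exists U.
by split=> //; apply/(matching_number_induced G (cardE U cU)).
Qed.
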